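(* Let $\Theta$ be a countable set, let $\{P_\theta : \theta\in\Theta\}$ be a model of conditional distributions of $Y$ given $X$ with conditional densities $f_\theta(y\mid x)$, and let $\pi$ be a probability mass function on $\Theta$, with associated joint Bayesian distribution $\Pi$, mixability gaps $\delta_n$, $\theta^*$-expected mixability gaps $\bar\delta_n$ and cumulative mixability gaps $\Delta_n$ as defined in the context. Suppose that the density ratios are uniformly bounded, i.e. there is a $v>1$ such that for all $(x,y)\in\mathcal X\times\mathcal Y$ and all $\theta,\theta'\in\Theta$, $$\frac{f_\theta(y\mid x)}{f_{\theta'}(y\mid x)}\le v .$$ Suppose further that for some $0<\eta<1$ we have $\sum_{\theta\in\Theta}\pi(\theta)^\eta<\infty$. Then for every $a>0$ there are constants $C_0$ and $C_1$ such that, for all $n\geq 1$, $$\Pi\left(\bar\delta_n\ \ge\ C_0\cdot\frac{\log n}{n}\right)\ \le\ C_1\cdot\frac1{n^{a}} .$$ Moreover, for any $0<a'\le 1$ there exist constants $C_2$ and $C_3$ such that, for all $n\ge 1$, $$\Pi\left(\Delta_n\ \ge\ C_2\cdot n^{a'}\right)\ \le\ C_3\cdot\frac{(\log n)^2}{n^{a'}} .$$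
   Context: All logarithms are natural. $\mathcal X$ and $\mathcal Y$ are measurable spaces. Each $\theta\in\Theta$ represents a conditional distribution $P_\theta(\cdot\mid x)$ on $\mathcal Y$ given $x\in\mathcal X$, with density $f_\theta(\cdot\mid x)$ with respect to a common underlying measure on $\mathcal Y$ (the same for all $\theta$ and $x$), extended to $n$ outcomes by independence: $f_\theta(y^n\mid x^n)=\prod_{i=1}^n f_\theta(y_i\mid x_i)$. The bound $f_\theta/f_{\theta'}\le v$ is to be read as $f_\theta(y\mid x)\le v\,f_{\theta'}(y\mid x)$. Write $Z_i=(X_i,Y_i)$ and $Z^n=(Z_1,\dots,Z_n)$. The covariates $X_1,X_2,\dots$ are i.i.d. from some fixed (arbitrary) distribution $P_X$ on $\mathcal X$. Joint Bayesian distribution $\Pi$: draw $\theta^*\in\Theta$ according to $\pi$; independently draw $X_1,X_2,\dots$ i.i.d. from $P_X$; and, given $\theta^*$ and the $X_i$, draw the $Y_i$ independently with $Y_i\sim P_{\theta^*}(\cdot\mid X_i)$. Thus, for measurable $A\subset\mathcal Y^n$, $\Pi(\theta^*=\theta,\,Y^n\in A\mid X^n=x^n)=\pi(\theta)\,P_{\theta}(A\mid X^n=x^n)$. All probabilities $\Pi(\cdot)$ in the theorem are with respect to this joint distribution of $(\theta^*,Z_1,Z_2,\dots)$. Posterior: $\pi(\theta\mid z^{m})=\dfrac{\pi(\theta)f_\theta(y^m\mid x^m)}{\sum_{\theta'\in\Theta}\pi(\theta')f_{\theta'}(y^m\mid x^m)}$, the standard Bayesian posterior mass function on $\Theta$ (equal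 to the prior $\pi$ if $m=0$); $\Pi\mid z^m$ denotes the corresponding distribution on $\Theta$. Mixability gap at sample size $i$ (a function of $z_1,\dots,z_i$): $$\delta_i:=\mathbf E_{\theta\sim\Pi\mid z^{i-1}}\left[-\log f_\theta(y_i\mid x_i)\right]-\left(-\log \mathbf E_{\theta\sim\Pi\mid z^{i-1}}\left[f_\theta(y_i\mid x_i)\right]\right)\ \ge 0 .$$ Cumulative mixability gap: $\Delta_n:=\sum_{i=1}^n\delta_i$. $\theta^*$-expected mixability gap: $\bar\delta_n:=\mathbf E_{\theta^*}[\delta_n]$, the expectation of $\delta_n$ when the data $Z_1,\dots,Z_n$ are generated from $\theta^*$ (i.e. $X_i$ i.i.d. from $P_X$, and $Y_i\mid X_i\sim P_{\theta^*}(\cdot\mid X_i)$ independently); it is a random variable through $\theta^*\sim\pi$. The constants $C_0,C_1$ (resp. $C_2,C_3$) may depend on the model, the prior, $P_X$, $v$, $\eta$ and on $a$ (resp. $a'$), but not on $n$. *)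

(* Defs.v *)
From HB Require Import structures.
From mathcomp Require Import all_boot all_order all_algebra.
From mathcomp Require Import all_classical all_reals all_analysis.
From mathcomp Require Import measurable_realfun.

Set Implicit Arguments.
Unset Strict Implicit.
Unset Printing Implicit Defensive.

Import Order.TTheory GRing.Theory Num.Theory.
Import numFieldNormedType.Exports.

Local Open Scope classical_set_scope.
Local Open Scope ring_scope.

Section discrete.
Context {R : realType} {Theta : countType}.

Definition is_pmf (p : Theta -> R) : Prop :=
  (forall t, 0 <= p t) /\ (\esum_(t in [set: Theta]) (p t)%:E = 1)%E.

(* Since [esum] is only meaningful for nonnegative terms, the sum is split into
   its positive and negative parts; [fine] discards nothing as soon as
   [p t * g t] is summable. *)
Definition pmf_mean (p g : Theta -> R) : R :=
  fine (\esum_(t in [set: Theta]) (Num.max (p t * g t) 0)%:E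
        - \esum_(t in [set: Theta]) (Num.max (- (p t * g t)) 0)%:E)%E.

End discrete.

Section cond_density.
Context d d' (X : measurableType d) (Y : measurableType d') (R : realType).

Definition is_cond_density (mu : {measure set Y -> \bar R}) (k : R.-pker X ~> Y)
    (g : X -> Y -> R) : Prop :=
  [/\ forall x y, 0 <= g x y,
      measurable_fun [set: X * Y] (fun z => g z.1 z.2) &
      forall x (B : set Y), measurable B ->
        k x B = (\int[mu]_(y in B) (g x y)%:E)%E].

End cond_density.

Section pair_law.
Context d d' (X : measurableType d) (Y : measurableType d') (R : realType).
Variables (PX : probability X R) (k : R.-pker X ~> Y).
Local Open Scope ereal_scope.

Definition pair_law (A : set (X * Y)) : \bar R :=
  \int[PX]_x k x (xsection A x).

Let pair_law0 : pair_law set0 = 0.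
Proof. by apply: integral0_eq => x _; rewrite xsection0 measure0. Qed.

Let pair_law_ge0 A : 0 <= pair_law A.
Proof. by apply: integral_ge0 => x _; exact: measure_ge0. Qed.

Let measurable_pair_law (A : set (X * Y)) : measurable A ->
  measurable_fun [set: X] (fun x => k x (xsection A x)).
Proof.
by move=> mA; apply: measurable_fun_xsection_finite_kernel; rewrite inE.
Qed.

Let pair_law_sigma_additive : semi_sigma_additive pair_law.
Proof.
move=> F mF tF mUF.
have -> : pair_law (\bigcup_n F n) = \sum_(n <oo) pair_law (F n).
  rewrite -integral_nneseries//; last by move=> n; exact: measurable_pair_law.
  apply: eq_integral => x _; rewrite xsection_bigcup.
  apply: measure_semi_bigcup => //.
  - by move=> n; exact: measurable_xsection.
  - exact: trivIset_xsection.
  - by apply: bigcup_measurable => n _; exact: measurable_xsection.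
by apply: is_cvg_nneseries => n _ _; exact: pair_law_ge0.
Qed.

HB.instance Definition _ := isMeasure.Build _ _ _ pair_law
  pair_law0 pair_law_ge0 pair_law_sigma_additive.

Let pair_lawT : pair_law [set: X * Y] = 1.
Proof.
rewrite /pair_law (eq_integral (fun=> 1)) => [|x _].
  by rewrite integral_cst// mul1e; exact: probability_setT.
rewrite (_ : xsection _ x = setT) ?prob_kernel//.
by apply/seteqP; split=> // y _; rewrite /xsection/= in_setT.
Qed.

HB.instance Definition _ :=
  Measure_isProbability.Build _ _ _ pair_law pair_lawT.

End pair_law.

Section iid_law.
Context d (T : measurableType d) (R : realType) (Q : probability T R).

Definition cons_pair n (p : T * n.-tuple T) : n.+1.-tuple T :=
  [tuple of p.1 :: p.2].

Let measurable_cons_pair n : measurable_fun setT (@cons_pair n).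
Proof. exact: (measurable_cons measurable_fst measurable_snd). Qed.

HB.instance Definition _ n :=
  isMeasurableFun.Build _ _ _ _ (@cons_pair n) (@measurable_cons_pair n).

(* The n-fold product of Q. *)
Fixpoint iid_law n : probability (n.-tuple T) R :=
  if n is m.+1 then distribution (Q \x iid_law m)%E (@cons_pair m)
  else dirac [tuple].

End iid_law.

Section mixability.
Context d d' (X : measurableType d) (Y : measurableType d') (R : realType).
Context (Theta : countType).
Variables (prior : Theta -> R) (f : Theta -> X -> Y -> R).

Definition likelihood (t : Theta) (s : seq (X * Y)) : R :=
  \prod_(z <- s) f t z.1 z.2.

Definition posterior (s : seq (X * Y)) (t : Theta) : R :=
  prior t * likelihood t s /
  fine (\esum_(u in [set: Theta]) (prior u * likelihood u s)%:E).

Definition gap_after (s : seq (X * Y)) (z : X * Y) : R :=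
  pmf_mean (posterior s) (fun t => - ln (f t z.1 z.2))
  - (- ln (pmf_mean (posterior s) (fun t => f t z.1 z.2))).

(* delta_i at the sample s = z_1, ..., z_i: the last element of s is predicted
   from the others. When all the densities vanish at some z_j, the conventions
   ln 0 = 0 and r / 0 = 0 apply; under a bound on the density ratios, all the
   densities vanish as soon as one does, hence with probability zero. *)
Definition mix_gap (s : seq (X * Y)) : R :=
  if s is z :: s' then gap_after (belast z s') (last z s') else 0.

Definition cumulative_gap (s : seq (X * Y)) : R :=
  \sum_(1 <= i < (size s).+1) mix_gap (take i s).

Variables (PX : probability X R) (P : Theta -> R.-pker X ~> Y).

Definition expected_gap n (t : Theta) : \bar R :=
  (\int[iid_law (pair_law PX (P t)) n]_s (mix_gap s)%:E)%E.

Definition sample dO (Omega : measurableType dO) (Z : nat -> Omega -> X * Y) n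
    (w : Omega) : n.-tuple (X * Y) :=
  [tuple Z i w | i < n].

(* Z_1, Z_2, ... are indexed from 0. As Theta is countable,
   the third clause determines the law of (theta*, Z_1, Z_2, ...). *)
Definition is_bayes_joint dO (Omega : measurableType dO)
    (Pi : probability Omega R) (thetastar : Omega -> Theta)
    (Z : nat -> Omega -> X * Y) : Prop :=
  [/\ forall t, measurable (thetastar @^-1` [set t]),
      forall i, measurable_fun [set: Omega] (Z i) &
      forall n t (A : set (n.-tuple (X * Y))), measurable A ->
        Pi [set w | thetastar w = t /\ A (sample Z n w)] =
        ((prior t)%:E * iid_law (pair_law PX (P t)) n A)%E].

End mixability.

(* Main.v *)
Require Import Defs.
From HB Require Import structures.
From mathcomp Require Import all_boot all_order all_algebra.
From mathcomp Require Import all_classical all_reals all_analysis.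
From mathcomp Require Import measurable_realfun.
From mathcomp Require Import ring lra.

Set Implicit Arguments.
Unset Strict Implicit.
Unset Printing Implicit Defensive.

Import Order.TTheory GRing.Theory Num.Theory.
Import numFieldNormedType.Exports.

Local Open Scope classical_set_scope.
Local Open Scope ring_scope.

(** Fix the true parameter t0 and write r_t = f_t / f_t0 for the density ratios
    at one observation. Everything is compared through (sqrt r_t - 1)^2, whose
    mean under t0 is the squared Hellinger distance d_t from P_t0 to P_t.

    The gap is small where the posterior is close to t0. As ln M <= M - 1, the
    mixability gap is at most the posterior mean of r - 1 - ln r, and on the
    range r >= 1/v this is at most 4 v (sqrt r - 1)^2 (log_gap_le_hellinger).
    So the gap is at most 4 v times the posterior mean of (sqrt r - 1)^2
    (gap_after_le). The past and the next observation are independent under t0,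
    so the expected gap after m observations is at most 4 v times the sum over t
    of E[posterior mass of t] * d_t.

    The posterior concentrates exponentially fast. The posterior mass of t is at
    most min(1, x) <= x^eta, with x the product of the prior odds of t against
    t0 and of the m density ratios (posterior_le_powR). The t0-mean of r is at
    most 1, and r^eta lies below its tangent at 1 by at least
    kappa (sqrt r - 1)^2 with kappa = min(eta, 1 - eta) (powR_add_hellinger). So
    E[r^eta] <= 1 - kappa d_t (affinity_hellinger), and the expected posterior
    mass of t is at most (prior t / prior t0)^eta exp(- kappa m d_t). The
    parameters with d_t <= eps contribute at most eps to the sum over t, because
    the posterior has mass at most 1; the others contribute at most a multiple
    of prior(t0)^(-eta) exp(- kappa m eps) S, where S is the sum of prior^eta
    (expected_gap_after_le).

    Suppose that prior(t0) > n^(- alpha). With eps a large multiple of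
    ln n / (m + 1), the second contribution is O(1/n), which bounds the expected
    gap at sample size m + 1 by C ln n / (m + 1) (expected_gap_rate). This is
    the first claim for such t0, taking m + 1 = n; summing over m gives
    O((ln n)^2) for the expected cumulative gap, and Markov's inequality gives
    the second claim. The remaining t0, those with prior(t0) <= tau, have
    total prior mass at most S tau^(1 - eta), because
    p <= p^eta tau^(1 - eta) for p <= tau; with tau = n^(- alpha) and
    alpha = a / (1 - eta) this is S n^(- a) (bayes_joint_tail). *)

(** * Scalar inequalities *)

Section scalar_inequalities.
Context {R : realType}.
Implicit Types x v p eta : R.

(** Bernoulli's inequality for exponents in ]0, 1]: x^p is concave in x, so it
    lies below its tangent at 1. *)
Lemma powR_le_tangent x p : 0 <= x -> 0 < p -> p <= 1 ->
  x `^ p <= 1 + p * (x - 1).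
Proof.
rewrite le_eqVlt => /predU1P[<- p0 p1|x0 p0 p1].
  by rewrite powR0 ?gt_eqF//; lra.
rewrite /powR gt_eqF//; set u := ln x.
(* With y = x^p, bound x / y and 1 / y from below by 1 + t <= exp t; their
   combination with weights p and 1 - p is free of u. *)
have xE : x = expR (p * u) * expR ((1 - p) * u).
  by rewrite -expRD -mulrDl addrC subrK mul1r lnK.
have oneE : 1 = expR (p * u) * expR (- (p * u)) by rewrite -expRD subrr expR0.
have y0 := expR_gt0 (p * u).
have hx : expR (p * u) * (1 + (1 - p) * u) <= x.
  by rewrite [leRHS]xE ler_pM2l// expR_ge1Dx.
have h1 : expR (p * u) * (1 - p * u) <= 1.
  by rewrite [leRHS]oneE ler_pM2l// expR_ge1Dx.
have hp : p * (expR (p * u) * (1 + (1 - p) * u)) <= p * x by rewrite ler_pM2l.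
have hq : (1 - p) * (expR (p * u) * (1 - p * u)) <= (1 - p) * 1.
  by rewrite ler_wpM2l// subr_ge0.
have := lerD hp hq; lra.
Qed.

(** The tangent inequality applied to sqrt x with exponent 2 eta, or, when
    eta > 1/2, to 1 / sqrt x with exponent 2 (1 - eta). Bounding sqrt x rather
    than x leaves the quadratic remainder. *)
Lemma powR_add_hellinger x eta : 0 <= x -> 0 < eta -> eta < 1 ->
  x `^ eta + Num.min eta (1 - eta) * (Num.sqrt x - 1) ^+ 2 <= 1 + eta * (x - 1).
Proof.
move=> x0 eta0 eta1; set s := Num.sqrt x.
have s0 : 0 <= s by exact: sqrtr_ge0.
have xE : x = s ^+ 2 by rewrite sqr_sqrtr.
have powE p : x `^ p = s `^ (2 * p) by rewrite powRrM powR_mulrn// -xE.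
have [le_half|gt_half] := leP eta 2^-1.
  have -> : Num.min eta (1 - eta) = eta by apply/min_idPl; lra.
  have := @powR_le_tangent s (2 * eta) s0 ltac:(lra) ltac:(lra).
  by rewrite -powE xE => H; nra.
have -> : Num.min eta (1 - eta) = 1 - eta by apply/min_idPr; lra.
move: s0; rewrite le_eqVlt => /predU1P[s0|s0].
  by rewrite xE -s0 expr0n/= powR0 ?gt_eqF//; nra.
have sV : s^-1 * s = 1 by rewrite mulVf ?gt_eqF.
have sV0 : 0 <= s^-1 by rewrite invr_ge0 ltW.
have pE : x `^ eta = x * s^-1 `^ (2 * (1 - eta)).
  rewrite powRrM powR_mulrn// exprVn -xE.
  have xx : 0 < x by rewrite xE exprn_gt0.
  rewrite -powR_inv1// -powRrM -[in X in X * _](powRr1 x0) -powRD; last first.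
    by rewrite (gt_eqF xx) implybT.
  by congr (_ `^ _); ring.
have := @powR_le_tangent s^-1 (2 * (1 - eta)) sV0 ltac:(lra) ltac:(lra).
move=> /(ler_wpM2l x0); rewrite -pE => H.
apply: le_trans (lerD H (lexx _)) _.
rewrite le_eqVlt; apply/orP; left; apply/eqP.
have xsV : x * s^-1 = s by rewrite xE expr2 -mulrA (mulrC s s^-1) sV mulr1.
have -> : x * (1 + 2 * (1 - eta) * (s^-1 - 1)) =
  x + 2 * (1 - eta) * (x * s^-1 - x) by ring.
by rewrite xsV xE; ring.
Qed.

(** Since ln x >= 1 - 1/x, the left-hand side is at most (x - 1)^2 / x, which is
    (sqrt x - 1)^2 times (sqrt x + 1)^2 / x <= 2 (1 + 1/x). *)
Lemma log_gap_le_hellinger x v : 1 <= v -> v^-1 <= x ->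
  x - 1 - ln x <= 4 * v * (Num.sqrt x - 1) ^+ 2.
Proof.
move=> v1 vx; have v0 : 0 < v by lra.
have x0 : 0 < x by rewrite (lt_le_trans _ vx)// invr_gt0.
have Vx0 : 0 < x^-1 by rewrite invr_gt0.
have Vxv : x^-1 <= v by rewrite -[leRHS]invrK lef_pV2// ?posrE// invr_gt0.
have lnge : 1 - x^-1 <= ln x.
  have := @le_ln1Dx R (x^-1 - 1) ltac:(lra).
  by rewrite addrCA subrr addr0 lnV ?posrE//; lra.
set s := Num.sqrt x.
have s0 : 0 <= s by exact: sqrtr_ge0.
have xE : x = s ^+ 2 by rewrite sqr_sqrtr ?ltW.
have Vxx : x^-1 * x = 1 by rewrite mulVf ?gt_eqF.
have step : x - 2 + x^-1 = x^-1 * (s + 1) ^+ 2 * (s - 1) ^+ 2.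
  have -> : x^-1 * (s + 1) ^+ 2 * (s - 1) ^+ 2 = x^-1 * (x - 1) ^+ 2.
    by rewrite xE; ring.
  transitivity (x * (x^-1 * x) - 2 * (x^-1 * x) + x^-1); last by ring.
  by rewrite Vxx; ring.
have coef : x^-1 * (s + 1) ^+ 2 <= 4 * v.
  have : x^-1 * (s + 1) ^+ 2 <= x^-1 * (2 * (x + 1)).
    rewrite ler_pM2l// xE -subr_ge0.
    rewrite (_ : _ - _ = (s - 1) ^+ 2) ?sqr_ge0//; ring.
  have -> : x^-1 * (2 * (x + 1)) = 2 * (x^-1 * x + x^-1) by ring.
  by rewrite Vxx; lra.
apply: (@le_trans _ _ (x - 2 + x^-1)); first by lra.
by rewrite step ler_wpM2r// sqr_ge0.
Qed.
End scalar_inequalities.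

(** * Sums over a countable type and means under a mass function *)

Section countable_sums.
Local Open Scope ereal_scope.
Context {R : realType} {I : countType}.
Implicit Types g : I -> \bar R.

(** Transfers to countable index types what is known of series. *)
Lemma esum_pickle g : (forall t, 0 <= g t) ->
  \esum_(t in [set: I]) g t = \sum_(n <oo) oapp g 0 (@pickle_inv I n).
Proof.
move=> g0.
have o0 n : 0 <= oapp g 0 (@pickle_inv I n) by case: (pickle_inv n) => /=.
rewrite nneseries_esumT//.
transitivity (\esum_(n in pickle @` [set: I]) oapp g 0 (@pickle_inv I n)).
  rewrite esum_image; last by move=> x y _ _; exact: (pcan_inj pickleK).
  by apply: eq_esum => t _; rewrite pickleK_inv.
rewrite esum_mkcond; apply: eq_esum => n _; case: ifPn => // nI.
case E : (pickle_inv n) => [t|//]; case/negP: nI.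
by rewrite inE; exists t => //; have := @pickle_invK I n; rewrite /ocancel E.
Qed.

Lemma esumZ (c : R) g : (0 <= c)%R -> (forall t, 0 <= g t) ->
  \esum_(t in [set: I]) (c%:E * g t) = c%:E * \esum_(t in [set: I]) g t.
Proof.
move=> c0 g0; rewrite !esum_pickle//; last first.
  by move=> t; rewrite mule_ge0// lee_fin.
rewrite -nneseriesZl//; last by move=> n _; case: (pickle_inv n) => /=.
apply: eq_eseriesr => n _; case: (pickle_inv n) => //=; by rewrite mule0.
Qed.

Lemma le_esum_term (t : I) g : (forall t, 0 <= g t) ->
  g t <= \esum_(u in [set: I]) g u.
Proof.
move=> g0; apply: esum_ge; exists [set t].
  by split=> //; exact: finite_set1.
by rewrite fsbig_set1.
Qed.

Context d (T : measurableType d).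

Lemma measurable_esum (h : I -> T -> \bar R) :
  (forall t, measurable_fun [set: T] (h t)) -> (forall t x, 0 <= h t x) ->
  measurable_fun [set: T] (fun x => \esum_(t in [set: I]) h t x).
Proof.
move=> mh h0.
rewrite (_ : (fun x => _) = fun x =>
    \sum_(n <oo) oapp (fun t => h t x) 0 (@pickle_inv I n)).
  apply: ge0_emeasurable_sum => n.
    by move=> x _ _; case: (pickle_inv n) => /=.
  by move=> _; case: (pickle_inv n) => [t|] /=; [exact: mh|exact: measurable_cst].
by apply/funext => x; rewrite esum_pickle.
Qed.

Lemma integral_esum (mu : {measure set T -> \bar R}) (h : I -> T -> \bar R) :
  (forall t, measurable_fun [set: T] (h t)) -> (forall t x, 0 <= h t x) ->
  \int[mu]_x (\esum_(t in [set: I]) h t x) =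
  \esum_(t in [set: I]) \int[mu]_x h t x.
Proof.
move=> mh h0; rewrite esum_pickle; last by move=> t; exact: integral_ge0.
under eq_integral do rewrite esum_pickle//.
rewrite integral_nneseries//.
- apply: eq_eseriesr => n _; case: (pickle_inv n) => [t|] //=.
  exact: integral0.
- by move=> n; case: (pickle_inv n) => [t|] /=; [exact: mh|exact: measurable_cst].
- by move=> n x _; case: (pickle_inv n) => /=.
Qed.

End countable_sums.

Section pmf_mean_theory.
Context {R : realType} {I : countType}.
Variable p : I -> R.
Hypothesis p_pmf : is_pmf p.
Implicit Types (g : I -> R) (B : R).

Let p_ge0 t : 0 <= p t. Proof. by case: p_pmf => + _; exact. Qed.

Let wsum g := (\esum_(t in [set: I]) (p t * g t)%:E)%E.

Let wsum_fin g B : (forall t, 0 <= g t <= B) -> wsum g \is a fin_num.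
Proof.
move=> gB; rewrite ge0_fin_numE; last first.
  apply: esum_ge0 => t _; rewrite lee_fin mulr_ge0//.
  by have /andP[] := gB t.
apply: (@le_lt_trans _ _ (\esum_(t in [set: I]) (`|B|%:E * (p t)%:E))%E).
  apply: le_esum => t _; rewrite -EFinM lee_fin mulrC ler_wpM2r//.
  by have /andP[_ /le_trans->//] := gB t; exact: ler_norm.
rewrite esumZ//.
by have [_ p1] := p_pmf; rewrite p1 mule1 ltry.
Qed.

(** The splitting of g into positive and negative parts is one decomposition
    among others; choosing nonnegative functions adapted to each statement is
    what makes the mean linear. *)
Let pmf_mean_diff (g a b : I -> R) B : (forall t, g t = a t - b t) ->
  (forall t, 0 <= a t <= B) -> (forall t, 0 <= b t <= B) ->
  pmf_mean p g = fine (wsum a) - fine (wsum b).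
Proof.
move=> gE aB bB.
have a0 t : 0 <= a t by have /andP[] := aB t.
have b0 t : 0 <= b t by have /andP[] := bB t.
pose gp t := Num.max (g t) 0; pose gn t := Num.max (- g t) 0.
have gpB t : 0 <= gp t <= B.
  rewrite /gp le_max lexx orbT/= ge_max gE.
  by have /andP[_ ?] := aB t; have := a0 t; have := b0 t; lra.
have gnB t : 0 <= gn t <= B.
  rewrite /gn le_max lexx orbT/= ge_max gE.
  by have /andP[_ ?] := bB t; have := a0 t; have := b0 t; lra.
have mean_parts : pmf_mean p g = fine (wsum gp - wsum gn)%E.
  rewrite /pmf_mean /wsum; congr (fine (_ - _)%E); apply: eq_esum => t _.
    by rewrite /gp maxr_pMr// mulr0.
  by rewrite /gn maxr_pMr// mulr0 mulrN.
rewrite mean_parts fineB ?(wsum_fin gpB) ?(wsum_fin gnB)//.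
have sumE : (wsum gp + wsum b = wsum gn + wsum a)%E.
  have nn (u : I -> R) : (forall t, 0 <= u t) ->
      forall t, [set: I] t -> (0 <= (p t * u t)%:E)%E.
    by move=> u0 t _; rewrite lee_fin mulr_ge0.
  have gp0 t : 0 <= gp t by have /andP[] := gpB t.
  have gn0 t : 0 <= gn t by have /andP[] := gnB t.
  rewrite /wsum -!esumD//; [|exact: nn..].
  apply: eq_esum => t _; rewrite -!EFinD -!mulrDr; congr (_ * _)%:E.
  rewrite /gp /gn gE; have [h|h] := leP (a t - b t) 0.
    by rewrite add0r max_l; lra.
  by rewrite max_r; lra.
have := congr1 fine sumE.
rewrite !fineD ?(wsum_fin gpB) ?(wsum_fin gnB) ?(wsum_fin aB) ?(wsum_fin bB)//.
lra.
Qed.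

Lemma pmf_mean_ge0E g B : (forall t, 0 <= g t <= B) ->
  ((pmf_mean p g)%:E = \esum_(t in [set: I]) (p t * g t)%:E)%E.
Proof.
move=> gB; have B0 (t : I) : 0 <= B by have /andP[/le_trans] := gB t; apply.
rewrite (@pmf_mean_diff g g (cst 0) B)//; first last.
- by move=> t; rewrite lexx/=; exact: B0 t.
- by move=> t; rewrite subr0.
rewrite [X in _ - fine X]esum1; last by move=> t _; rewrite mulr0.
by rewrite subr0 fineK// (wsum_fin gB).
Qed.

Let shift g B : (forall t, `|g t| <= B) -> (forall t, 0 <= g t + B <= B + B) /\
  (forall t : I, 0 <= cst B t <= B + B).
Proof.
move=> gB; split=> t.
  by have := gB t; rewrite ler_norml => /andP[? ?]; apply/andP; split; lra.
have B0 : 0 <= B by exact: le_trans (gB t).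
by rewrite /cst; apply/andP; split; lra.
Qed.

Let pmf_mean_shift g B : (forall t, `|g t| <= B) ->
  pmf_mean p g = fine (wsum (fun t => g t + B)) - fine (wsum (cst B)).
Proof.
move=> /shift[gB cB]; apply: (@pmf_mean_diff _ _ _ (B + B)) => //.
by move=> t; rewrite /cst addrK.
Qed.

Lemma le_pmf_mean g1 g2 B : (forall t, `|g1 t| <= B) -> (forall t, `|g2 t| <= B) ->
  (forall t, g1 t <= g2 t) -> pmf_mean p g1 <= pmf_mean p g2.
Proof.
move=> g1B g2B g12; rewrite (pmf_mean_shift g1B) (pmf_mean_shift g2B) lerB//.
have [B1 _] := shift g1B; have [B2 _] := shift g2B.
rewrite fine_le ?(wsum_fin B1) ?(wsum_fin B2)//.
by apply: le_esum => t _; rewrite lee_fin ler_wpM2l// lerD2r.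
Qed.

Lemma pmf_meanD g1 g2 B : (forall t, `|g1 t| <= B) -> (forall t, `|g2 t| <= B) ->
  pmf_mean p (fun t => g1 t + g2 t) = pmf_mean p g1 + pmf_mean p g2.
Proof.
move=> g1B g2B; rewrite (pmf_mean_shift g1B) (pmf_mean_shift g2B).
have [B1 Bc] := shift g1B; have [B2 _] := shift g2B.
rewrite (@pmf_mean_diff _ (fun t => (g1 t + B) + (g2 t + B)) (cst (B + B))
  (B + B + (B + B))); first last.
- move=> t; have := Bc t; rewrite /cst => /andP[? ?]; apply/andP; split; lra.
- by move=> t; have /andP[? ?] := B1 t; have /andP[? ?] := B2 t;
    apply/andP; split; lra.
- by move=> t; rewrite /cst; ring.
have nn (u : I -> R) : (forall t, 0 <= u t <= B + B) ->
    forall t, [set: I] t -> (0 <= (p t * u t)%:E)%E.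
  by move=> u0 t _; rewrite lee_fin mulr_ge0//; have /andP[] := u0 t.
have wsumD (u w : I -> R) : (forall t, 0 <= u t <= B + B) ->
    (forall t, 0 <= w t <= B + B) ->
    fine (wsum (fun t => u t + w t)) = fine (wsum u) + fine (wsum w).
  move=> uB wB; rewrite -fineD ?(wsum_fin uB) ?(wsum_fin wB)//.
  rewrite /wsum -esumD; [|exact: nn|exact: nn].
  by congr fine; apply: eq_esum => t _; rewrite mulrDr EFinD.
have -> : fine (wsum (cst (B + B))) = fine (wsum (cst B)) + fine (wsum (cst B)).
  by rewrite -wsumD.
by rewrite wsumD//; ring.
Qed.

Lemma pmf_meanZ c g B : 0 <= c -> (forall t, `|g t| <= B) ->
  pmf_mean p (fun t => c * g t) = c * pmf_mean p g.
Proof.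
move=> c0 gB; rewrite (pmf_mean_shift gB); have [B1 Bc] := shift gB.
rewrite (@pmf_mean_diff _ (fun t => c * (g t + B)) (fun=> c * B)
  (c * (B + B))); first last.
- by move=> t; have /andP[? ?] := Bc t; rewrite mulr_ge0//= ler_wpM2l.
- by move=> t; have /andP[? ?] := B1 t; rewrite mulr_ge0//= ler_wpM2l.
- by move=> t; ring.
have wsumZ (u : I -> R) : (forall t, 0 <= u t <= B + B) ->
    fine (wsum (fun t => c * u t)) = c * fine (wsum u).
  move=> uB; have -> : c * fine (wsum u) = fine (c%:E * wsum u)%E.
    by rewrite fineM// (wsum_fin uB).
  rewrite /wsum -esumZ//; last first.
    by move=> t; rewrite lee_fin mulr_ge0//; have /andP[] := uB t.
  by congr fine; apply: eq_esum => t _; rewrite -EFinM mulrCA.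
by rewrite wsumZ// (wsumZ (cst B))// mulrBr.
Qed.

Lemma pmf_mean_cst c : pmf_mean p (fun=> c) = c.
Proof.
have cB (t : I) : `|(fun=> c) t| <= `|c| by [].
have one : fine (wsum (cst 1)) = 1.
  rewrite /wsum (_ : (\esum_(t in _) _)%E = 1%E)//.
  by have [_ <-] := p_pmf; apply: eq_esum => t _; rewrite mulr1.
have ge0_cst b : 0 <= b -> fine (wsum (cst b)) = b.
  move=> b0; rewrite -[RHS](mulr1 b) -one.
  have -> : b * fine (wsum (cst 1)) = fine (b%:E * wsum (cst 1%R))%E.
    by rewrite fineM//; apply: (@wsum_fin _ 1) => t /=; rewrite ler01 lexx.
  rewrite /wsum -esumZ//; last by move=> t; rewrite lee_fin mulr_ge0.
  by congr fine; apply: eq_esum => t _; rewrite -EFinM mulr1 mulrC.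
transitivity (fine (wsum (cst (c + `|c|))) - fine (wsum (cst `|c|))).
  by rewrite (pmf_mean_shift cB).
rewrite !ge0_cst//; first by ring.
by rewrite -[leLHS](addNr `|c|) lerD2r lerNl -normrN ler_norm.
Qed.

End pmf_mean_theory.

(** * Integration against a density and against the law of a pair *)

Section nonneg_measurable_induction.
Local Open Scope ereal_scope.
Context d (T : measurableType d) (R : realType).

Import HBNNSimple.

(** The standard machine: nonnegative measurable functions are increasing limits
    of nonnegative combinations of indicators. *)
Lemma nonneg_measurable_ind (S : (T -> \bar R) -> Prop) :
  (forall A, measurable A -> S (EFin \o \1_A)) ->
  (forall (c : R) (g : T -> \bar R), (0 <= c)%R -> measurable_fun [set: T] g ->
    (forall x, 0 <= g x) -> S g -> S (fun x => c%:E * g x)) ->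
  (forall g h : T -> \bar R, measurable_fun [set: T] g -> measurable_fun [set: T] h ->
    (forall x, 0 <= g x) -> (forall x, 0 <= h x) -> S g -> S h ->
    S (fun x => g x + h x)) ->
  (forall g : (T -> \bar R)^nat, (forall n, measurable_fun [set: T] (g n)) ->
    (forall n x, 0 <= g n x) ->
    (forall x, nondecreasing_seq (g ^~ x)) -> (forall n, S (g n)) ->
    S (fun x => limn (g ^~ x))) ->
  forall g : T -> \bar R,
    measurable_fun [set: T] g -> (forall x, 0 <= g x) -> S g.
Proof.
move=> S1 SZ SD Slim g mg g0.
have S_ind (c : R) A : (0 <= c)%R -> measurable A ->
    S (fun x => (c * \1_A x)%:E).
  by move=> c0 mA; apply: (SZ c (EFin \o \1_A)) => //;
    [exact/measurable_EFinP|by move=> x; rewrite lee_fin|exact: S1].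
have S_nnsfun (h : {nnsfun T >-> R}) : S (EFin \o h).
  have -> : EFin \o h = (fun x =>
      \sum_(r <- finmap.enum_fset (fset_set (range h))) (r * \1_(h @^-1` [set r]) x)%:E).
    by apply/funext => x; rewrite /= fimfunE fsbig_finite//= sumEFin.
  have r0 r : r \in finmap.enum_fset (fset_set (range h)) -> (0 <= r)%R.
    move=> rh; have /set_mem[x _ <-//] : r \in range h.
    by rewrite -in_fset_set//; exact: rh.
  elim: (finmap.enum_fset _) r0 => [_|r s ih rs0].
    rewrite (_ : (fun _ => _) = EFin \o \1_set0); first exact: S1.
    by apply/funext => x; rewrite big_nil/= indicE in_set0.
  have r0 : (0 <= r)%R by apply: rs0; rewrite mem_head.
  have s0 q : q \in s -> (0 <= q)%R by move=> qs; apply: rs0; rewrite inE qs orbT.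
  have mterm q : measurable_fun [set: T] (fun x => (q * \1_(h @^-1` [set q]) x)%:E).
    by apply/measurable_EFinP; apply: measurable_funM.
  under eq_fun do rewrite big_cons.
  apply: SD => //.
  - exact: emeasurable_sum.
  - by move=> x; rewrite lee_fin mulr_ge0// indicE.
  - move=> x; rewrite big_seq; apply: sume_ge0 => q qs.
    by rewrite lee_fin mulr_ge0 ?(s0 q)// indicE.
  - exact: S_ind.
  - exact: ih.
pose h := nnsfun_approx measurableT mg.
rewrite (_ : g = fun x => limn (fun n => (h n x)%:E)).
  apply: (Slim (fun n => EFin \o h n)) => //.
  - by move=> n; exact/measurable_EFinP.
  - by move=> n x; rewrite lee_fin.
  - by move=> x m n mn; rewrite lee_fin; exact/lefP/nd_nnsfun_approx.
by apply/funext => x; apply/esym/cvg_lim => //; exact: cvg_nnsfun_approx.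
Qed.

End nonneg_measurable_induction.

Section density_integral.
Local Open Scope ereal_scope.
Context d (T : measurableType d) (R : realType).

(** The measure mu is arbitrary, possibly not sigma-finite, so this does not go
    through Radon-Nikodym derivatives. *)
Lemma integral_density (mu nu : {measure set T -> \bar R}) (p : T -> R)
    (g : T -> \bar R) :
  measurable_fun [set: T] p -> (forall x, 0 <= p x)%R ->
  (forall A, measurable A -> nu A = \int[mu]_(x in A) (p x)%:E) ->
  measurable_fun [set: T] g -> (forall x, 0 <= g x) ->
  \int[nu]_x g x = \int[mu]_x (g x * (p x)%:E).
Proof.
move=> mp p0 nuE; have mEp : measurable_fun [set: T] (EFin \o p).
  exact/measurable_EFinP.
have p0' x : 0 <= (p x)%:E by rewrite lee_fin.
move: g; apply: nonneg_measurable_ind.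
- move=> A mA; rewrite integral_indic// setIT nuE//.
  rewrite integral_mkcond; apply: eq_integral => x _ /=.
  by rewrite patchE indicE; case: ifPn => _; rewrite ?mul1e ?mul0e.
- move=> c g c0 mg g0 IH; rewrite ge0_integralZl ?lee_fin// IH.
  under [RHS]eq_integral do rewrite -muleA.
  rewrite ge0_integralZl ?lee_fin//; first exact: emeasurable_funM.
  by move=> x _; rewrite mule_ge0.
- move=> g h mg mh g0 h0 IHg IHh; rewrite ge0_integralD// IHg IHh.
  under [RHS]eq_integral do rewrite ge0_muleDl//.
  rewrite ge0_integralD//; try exact: emeasurable_funM.
    by move=> x _; rewrite mule_ge0.
  by move=> x _; rewrite mule_ge0.
- move=> g mg g0 ndg IH; rewrite monotone_convergence//.
  under eq_fun do rewrite IH.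
  rewrite -monotone_convergence//.
  + apply: eq_integral => x _; rewrite -limeMr//.
    by apply: ereal_nondecreasing_is_cvgn; exact: ndg.
  + by move=> n; exact: emeasurable_funM.
  + by move=> n x _; rewrite mule_ge0.
  + by move=> x _ m n mn; rewrite lee_wpmul2r//; exact: ndg.
Qed.

End density_integral.

Section pair_law_integral.
Local Open Scope ereal_scope.
Context d d' (X : measurableType d) (Y : measurableType d') (R : realType).
Variables (PX : probability X R) (k : R.-pker X ~> Y).

Lemma integral_pair_law (g : X * Y -> \bar R) :
  measurable_fun [set: X * Y] g -> (forall z, 0 <= g z) ->
  \int[pair_law PX k]_z g z = \int[PX]_x \int[k x]_y g (x, y).
Proof.
have mpair (h : X * Y -> \bar R) x : measurable_fun [set: X * Y] h ->
    measurable_fun [set: Y] (fun y => h (x, y)).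
  by move=> mh; exact: measurableT_comp.
have mint (h : X * Y -> \bar R) : measurable_fun [set: X * Y] h ->
    (forall z, 0 <= h z) -> measurable_fun [set: X] (fun x => \int[k x]_y h (x, y)).
  by move=> mh h0; exact: measurable_fun_integral_finite_kernel.
have int0 (h : X * Y -> \bar R) x : (forall z, 0 <= h z) ->
    0 <= \int[k x]_y h (x, y).
  by move=> h0; exact: integral_ge0.
move: g; apply: nonneg_measurable_ind.
- move=> A mA; rewrite integral_indic// setIT.
  apply: eq_integral => x _.
  rewrite -[LHS]mul1e -integral_cst//; last exact: measurable_xsection.
  rewrite integral_mkcond; apply: eq_integral => y _ /=.
  by rewrite patchE mem_xsection indicE; case: ifPn.
- move=> c g c0 mg g0 IH; 
  transitivity (c%:E * \int[pair_law PX k]_z g z); first exact: ge0_integralZl.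
  rewrite IH.
  transitivity (\int[PX]_x (c%:E * \int[k x]_y g (x, y))).
    apply/esym/(ge0_integralZl _ measurableT (mint _ mg g0)) => //.
    by move=> x _; exact: int0.
  apply: eq_integral => x _; apply/esym.
  exact: (ge0_integralZl _ measurableT (mpair _ x mg)).
- move=> g h mg mh g0 h0 IHg IHh; 
  transitivity (\int[pair_law PX k]_z g z + \int[pair_law PX k]_z h z).
    exact: ge0_integralD.
  rewrite IHg IHh.
  transitivity (\int[PX]_x (\int[k x]_y g (x, y) + \int[k x]_y h (x, y))).
    apply/esym/(ge0_integralD _ measurableT _ (mint _ mg g0) _ (mint _ mh h0)).
      by move=> x _; exact: int0.
    by move=> x _; exact: int0.
  apply: eq_integral => x _; apply/esym.
  exact: (ge0_integralD _ measurableT _ (mpair _ x mg) _ (mpair _ x mh)).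
- move=> g mg g0 ndg IH; rewrite monotone_convergence//.
  under eq_fun do rewrite IH.
  rewrite -monotone_convergence//.
  + by apply: eq_integral => x _; rewrite monotone_convergence// => n; exact: mpair.
  + by move=> n; exact: mint.
  + by move=> n x _; exact: int0.
  + move=> x _ m n mn; apply: ge0_le_integral => //.
    * exact: mpair.
    * exact: mpair.
    * by move=> y _; exact: ndg.
Qed.

End pair_law_integral.

(** * Integration against an i.i.d. sample *)

Lemma integral_prob_cst d (T : measurableType d) (R : realType)
    (P : probability T R) (c : \bar R) : (\int[P]_x c = c)%E.
Proof.
rewrite [LHS](@integral_cst _ _ _ P setT measurableT c).
by rewrite -[RHS]mule1; congr (_ * _)%E; exact: probability_setT.
Qed.

Section iid_law_integral.
Local Open Scope ereal_scope.
Context d (T : measurableType d) (R : realType) (Q : probability T R).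

Lemma integral_iid_lawS n (F : n.+1.-tuple T -> \bar R) :
  measurable_fun [set: n.+1.-tuple T] F -> (forall s, 0 <= F s) ->
  \int[iid_law Q n.+1]_s F s = \int[Q]_x \int[iid_law Q n]_s F (cons_pair (x, s)).
Proof.
move=> mF F0; rewrite ge0_integral_distribution//.
rewrite (fubini_tonelli1 (F \o @cons_pair _ T n))//.
  exact: measurableT_comp.
by move=> p; exact: F0.
Qed.

(** The posterior is a function of samples of any length; it is measurable
    length by length. *)
Definition seq_measurable (A : seq T -> \bar R) :=
  forall n, measurable_fun [set: n.-tuple T] (fun s => A s).

Lemma seq_measurable_cons A x : seq_measurable A ->
  seq_measurable (fun s => A (x :: s)).
Proof.
move=> mA n.
have mcons : measurable_fun [set: n.-tuple T] (fun s => [tuple of x :: s]).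
  exact: measurable_cons.
exact: (measurableT_comp (mA n.+1) mcons).
Qed.

Lemma measurable_take m n :
  measurable_fun [set: n.-tuple T] (fun s => [tuple of take m s]).
Proof.
apply/measurable_fun_tnthP => i.
have i_n : (i < n)%N by rewrite (leq_trans (ltn_ord i))// geq_minr.
have i_m : (i < m)%N by rewrite (leq_trans (ltn_ord i))// geq_minl.
rewrite (_ : _ \o _ = fun s : n.-tuple T => tnth s (Ordinal i_n)).
  exact: measurable_tnth.
apply/funext => s /=; rewrite (tnth_nth (tnth s (Ordinal i_n))) /= nth_take//.
by rewrite [RHS](tnth_nth (tnth s (Ordinal i_n))).
Qed.

Lemma seq_measurable_take A m : seq_measurable A ->
  seq_measurable (fun s => A (take m s)).
Proof.
by move=> mA n; exact: (measurableT_comp (mA (minn m n)) (@measurable_take m n)).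
Qed.

Lemma seq_measurable_prod (h : T -> R) : measurable_fun [set: T] h ->
  seq_measurable (fun s => (\prod_(z <- s) h z)%:E).
Proof.
move=> mh n; apply/measurable_EFinP.
rewrite (_ : (fun s : n.-tuple T => _) = fun s => \prod_(i < n) h (tnth s i))%R.
  apply: measurable_prod => i _.
  exact: measurableT_comp (measurable_tnth _).
by apply/funext => s; rewrite big_tuple.
Qed.

(** Independence of an observation and of those before it. *)
Lemma integral_iid_law_past_present n (i : 'I_n) (A : seq T -> \bar R)
    (g : T -> \bar R) :
  seq_measurable A -> (forall s, 0 <= A s) ->
  measurable_fun [set: T] g -> (forall x, 0 <= g x) ->
  \int[iid_law Q n]_s (A (take i s) * g (tnth s i)) =
  \int[iid_law Q n]_s A (take i s) * \int[Q]_x g x.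
Proof.
move=> + + mg g0; elim: n i A => [[]//|n IH] i A mA A0.
have mtnth k (j : 'I_k) : measurable_fun [set: k.-tuple T] (fun s => g (tnth s j)).
  exact: measurableT_comp (measurable_tnth _).
rewrite [in LHS]integral_iid_lawS//; last 2 first.
- apply: emeasurable_funM; [exact: seq_measurable_take|exact: mtnth].
- by move=> s; rewrite mule_ge0.
rewrite [in RHS]integral_iid_lawS//; last first.
  exact: seq_measurable_take.
have [j ij|i0] := unliftP ord0 i; last first.
  subst i.
  transitivity (\int[Q]_x (A [::] * g x)).
    apply: eq_integral => x _.
    rewrite (eq_integral (cst (A [::] * g x))); last first.
      by move=> s _; rewrite take0 tnth0.
    exact: integral_prob_cst.
  rewrite ge0_integralZl//; congr (_ * _); apply/esym.
  rewrite (eq_integral (cst (A [::]))) => [|x _].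
    exact: integral_prob_cst.
  rewrite (eq_integral (cst (A [::]))) => [|s _]; last by rewrite take0.
  exact: integral_prob_cst.
have takeE (x : T) (s : n.-tuple T) : take i (cons_pair (x, s)) = x :: take j s.
  by rewrite ij.
have tnthE (x : T) (s : n.-tuple T) : tnth (cons_pair (x, s)) i = tnth s j.
  by rewrite ij tnthS.
under eq_integral do under eq_integral do rewrite takeE tnthE.
under [in RHS]eq_integral do under eq_integral do rewrite takeE.
under eq_integral => x _ do
  rewrite (IH j (fun s => A (x :: s)) (seq_measurable_cons x mA) (fun s => A0 (x :: s))).
rewrite ge0_integralZr//.
- apply: (@measurable_fun_fubini_tonelli_F _ _ _ _ _ (iid_law Q n)
    (fun p => A (p.1 :: take j p.2))) => //.
  have mtake : measurable_fun [set: T * n.-tuple T]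
      (fun p => [tuple of p.1 :: [tuple of take j p.2]]).
    apply: measurable_cons => //.
    exact: measurableT_comp (@measurable_take j n) measurable_snd.
  exact: measurableT_comp (mA _) mtake.
- by move=> x _; apply: integral_ge0.
- exact: integral_ge0.
Qed.

Lemma integral_iid_law_prod n m (h : T -> R) (a : R) : (m <= n)%N ->
  measurable_fun [set: T] h -> (forall x, 0 <= h x)%R ->
  \int[Q]_x (h x)%:E = a%:E ->
  \int[iid_law Q n]_s (\prod_(z <- take m s) h z)%:E = (a ^+ m)%:E.
Proof.
move=> + mh h0 hE; elim: m n => [|m IH] n.
  move=> _; under eq_integral do rewrite take0 big_nil.
  exact: integral_prob_cst.
case: n => // n mn.
have mprod k : seq_measurable (fun s => (\prod_(z <- take k s) h z)%:E).
  exact: seq_measurable_take (seq_measurable_prod mh).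
have prod0 s : (0 <= \prod_(z <- s) h z)%R by exact: prodr_ge0.
rewrite integral_iid_lawS; [|exact: (mprod m.+1 n.+1)|by move=> s; rewrite lee_fin].
transitivity (\int[Q]_x ((h x)%:E * (a ^+ m)%:E)).
  apply: eq_integral => x _.
  under eq_integral do rewrite /= big_cons EFinM.
  rewrite ge0_integralZl ?lee_fin//; first by rewrite IH.
    exact: (mprod m n).
  by move=> s _; rewrite lee_fin.
rewrite ge0_integralZr//; first by rewrite hE -EFinM exprS.
- exact/measurable_EFinP.
- by move=> x _; rewrite lee_fin.
- rewrite lee_fin exprn_ge0// -lee_fin -hE integral_ge0// => x _.
  by rewrite lee_fin.
Qed.

End iid_law_integral.

(** * The posterior and the mixability gap at a fixed sample *)

Section pmf_mean_more.
Context {R : realType} {I : countType}.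
Implicit Types (p g u w h : I -> R) (a b c B : R).

Lemma pmf_mean0 p g : (forall t, p t = 0) -> pmf_mean p g = 0.
Proof.
move=> p0; rewrite /pmf_mean !esum1 ?subee// => t _;
  by rewrite p0 mul0r ?oppr0 maxxx.
Qed.

Variable p : I -> R.
Hypothesis p_pmf : is_pmf p.

Lemma pmf_meanN g B : (forall t, `|g t| <= B) ->
  pmf_mean p (fun t => - g t) = - pmf_mean p g.
Proof.
move=> gB; have ngB t : `|- g t| <= B by rewrite normrN.
apply/eqP; rewrite -subr_eq0 opprK addrC -(pmf_meanD p_pmf gB ngB).
rewrite (_ : (fun t => _) = fun=> 0); first by rewrite pmf_mean_cst.
by apply/funext => t; rewrite subrr.
Qed.

(** All comparisons of logarithms with densities under the posterior have this
    form. *)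
Lemma pmf_mean_le_affine u w h B a b c : 0 <= b -> 0 <= c ->
  (forall t, `|u t| <= B) -> (forall t, `|w t| <= B) -> (forall t, `|h t| <= B) ->
  (forall t, u t + b * w t <= a + c * h t) ->
  pmf_mean p u + b * pmf_mean p w <= a + c * pmf_mean p h.
Proof.
move=> b0 c0 uB wB hB le_uwh.
pose M := `|a| + (1 + b + c) * `|B|.
have [oneM bM cM] : [/\ 1 <= 1 + b + c, b <= 1 + b + c & c <= 1 + b + c].
  by split; lra.
have BB : B <= `|B| by exact: ler_norm.
have a0 := normr_ge0 a; have B0 := normr_ge0 B.
have scale (d : R) g : 0 <= d -> d <= 1 + b + c -> (forall t, `|g t| <= B) ->
    forall t, `|d * g t| <= M.
  move=> d0 dM gB t; rewrite normrM (ger0_norm d0) /M.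
  apply: (@le_trans _ _ (d * `|B|)).
    by rewrite ler_wpM2l// (le_trans (gB t)).
  by rewrite (le_trans (ler_wpM2r _ dM))// lerDr.
have uM t : `|u t| <= M.
  by have := @scale 1 u ler01 oneM uB t; rewrite mul1r.
have aM (t : I) : `|(fun=> a) t| <= M by rewrite /M lerDl mulr_ge0// (le_trans _ oneM).
have wM := scale b w b0 bM wB.
have hM := scale c h c0 cM hB.
rewrite -(pmf_meanZ p_pmf b0 wB) -(pmf_meanZ p_pmf c0 hB).
rewrite -[in leRHS](pmf_mean_cst p_pmf a).
rewrite -(pmf_meanD p_pmf uM wM) -(pmf_meanD p_pmf aM hM).
apply: (@le_pmf_mean _ _ p p_pmf _ _ (M + M)) => // t.
  by rewrite (le_trans (ler_normD _ _))// lerD.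
by rewrite (le_trans (ler_normD _ _))// lerD// aM.
Qed.

End pmf_mean_more.

Section posterior_bounds.
Context d d' (X : measurableType d) (Y : measurableType d') (R : realType).
Context (Theta : countType).
Variables (prior : Theta -> R) (f : Theta -> X -> Y -> R) (v : R).
Hypotheses (prior_pmf : is_pmf prior) (v_gt1 : 1 < v).
Hypothesis f_ge0 : forall t x y, 0 <= f t x y.
Hypothesis ratio_bounded : forall x y t t', f t x y <= v * f t' x y.
Implicit Types (t u : Theta) (z : X * Y) (s : seq (X * Y)).

(** Where the densities vanish this is 0, which escapes the lower bound 1/v;
    there the gap is 0 as well. *)
Definition density_ratio t0 t z : R := f t z.1 z.2 / f t0 z.1 z.2.

Definition sq_hellinger t0 t z : R := (Num.sqrt (density_ratio t0 t z) - 1) ^+ 2.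

Let v_gt0 : 0 < v. Proof. exact: lt_trans v_gt1. Qed.

Let prior_ge0 t : 0 <= prior t. Proof. by have [] := prior_pmf. Qed.

Lemma density_ratio_ge0 t0 t z : 0 <= density_ratio t0 t z.
Proof. by rewrite /density_ratio divr_ge0. Qed.

Lemma density_ratio_le t0 t z : density_ratio t0 t z <= v.
Proof.
have [f0|f0] := eqVneq (f t0 z.1 z.2) 0.
  by rewrite /density_ratio f0 invr0 mulr0 ltW.
by rewrite ler_pdivrMr ?lt_neqAle ?f_ge0 1?eq_sym ?f0.
Qed.

Lemma density_ratio_ge t0 t z : 0 < f t0 z.1 z.2 -> v^-1 <= density_ratio t0 t z.
Proof. by move=> f0; rewrite ler_pdivlMr// mulrC ler_pdivrMr// mulrC. Qed.

Lemma sq_hellinger_ge0 t0 t z : 0 <= sq_hellinger t0 t z.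
Proof. exact: sqr_ge0. Qed.

Lemma sq_hellinger_le t0 t z : sq_hellinger t0 t z <= v + 1.
Proof.
have := density_ratio_le t0 t z; have r0 := density_ratio_ge0 t0 t z.
rewrite /sq_hellinger -[X in X <= v -> _](sqr_sqrtr r0).
by have := sqrtr_ge0 (density_ratio t0 t z); move: (Num.sqrt _) => q; nra.
Qed.

Lemma likelihood_ge0 t s : 0 <= likelihood f t s.
Proof. by apply: prodr_ge0. Qed.

(** In particular, if one likelihood vanishes then they all do. *)
Lemma likelihood_le t t' s :
  likelihood f t s <= v ^+ size s * likelihood f t' s.
Proof.
rewrite /likelihood; elim: s => [|z s IH]; first by rewrite !big_nil mul1r.
rewrite !big_cons /= exprS mulrACA ler_pM// ?f_ge0//.
exact: likelihood_ge0.
Qed.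

Let prior_pos : exists t, 0 < prior t.
Proof.
apply: contrapT => noprior; have [_] := prior_pmf; rewrite esum1.
  by move=> /eqP; rewrite eq_sym onee_eq0.
move=> t _; congr EFin; apply/eqP; rewrite eq_le prior_ge0 andbT leNgt.
by apply/negP => t0; apply: noprior; exists t.
Qed.

Let evidence s := (\esum_(t in [set: Theta]) (prior t * likelihood f t s)%:E)%E.

Let evidence_fin s : evidence s \is a fin_num.
Proof.
have [t0 _] := prior_pos.
rewrite ge0_fin_numE; last first.
  by apply: esum_ge0 => t _; rewrite lee_fin mulr_ge0 ?likelihood_ge0.
apply: (@le_lt_trans _ _
    (\esum_(t in [set: Theta]) ((v ^+ size s * likelihood f t0 s)%:E * (prior t)%:E))%E).
  apply: le_esum => t _; rewrite -EFinM lee_fin mulrC ler_wpM2r//.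
  exact: likelihood_le.
rewrite esumZ ?mulr_ge0 ?likelihood_ge0 ?exprn_ge0 ?(ltW v_gt0)//.
by have [_ ->] := prior_pmf; rewrite mule1 ltry.
Qed.

Lemma is_pmf_posterior t0 s : 0 < likelihood f t0 s ->
  is_pmf (posterior prior f s).
Proof.
move=> lik0; have [t1 prior1] := prior_pos.
have lik1 : 0 < likelihood f t1 s.
  have := lt_le_trans lik0 (likelihood_le t0 t1 s).
  by rewrite pmulr_rgt0// exprn_gt0.
have ev0 : 0 < fine (evidence s).
  apply: (@lt_le_trans _ _ (prior t1 * likelihood f t1 s)); first exact: mulr_gt0.
  rewrite -lee_fin fineK//.
  apply: (@le_esum_term _ _ t1 (fun t => (prior t * likelihood f t s)%:E)) => t.
  by rewrite lee_fin mulr_ge0 ?likelihood_ge0.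
split=> [t|]; first by rewrite divr_ge0 ?mulr_ge0 ?likelihood_ge0// ltW.
transitivity (\esum_(t in [set: Theta])
    ((fine (evidence s))^-1%:E * (prior t * likelihood f t s)%:E))%E.
  by apply: eq_esum => t _; rewrite -EFinM mulrC.
rewrite esumZ ?invr_ge0 ?(ltW ev0)//; last first.
  by move=> t; rewrite lee_fin mulr_ge0 ?likelihood_ge0.
rewrite -/(evidence s) -[X in (_ * X)%E]fineK//.
by rewrite -EFinM mulVf// gt_eqF.
Qed.

Lemma posterior_eq0 t0 t s : likelihood f t0 s = 0 -> posterior prior f s t = 0.
Proof.
move=> lik0; rewrite /posterior (_ : likelihood f t s = 0) ?mulr0 ?mul0r//.
apply/eqP; rewrite eq_le likelihood_ge0 andbT.
by have := likelihood_le t t0 s; rewrite lik0 mulr0.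
Qed.

(** The posterior vanishes identically when the likelihoods do. *)
Lemma posterior_dichotomy s :
  is_pmf (posterior prior f s) \/ (forall t, posterior prior f s t = 0).
Proof.
have [t0 _] := prior_pos.
have := likelihood_ge0 t0 s; rewrite le_eqVlt => /predU1P[lik0|lik0].
  by right=> t; apply: (@posterior_eq0 t0).
by left; exact: is_pmf_posterior lik0.
Qed.

Lemma posterior_ge0 s t : 0 <= posterior prior f s t.
Proof. by have [[]|->] := posterior_dichotomy s. Qed.

Lemma esum_posterior_le1 s :
  (\esum_(t in [set: Theta]) (posterior prior f s t)%:E <= 1)%E.
Proof.
have [[_ ->//]|p0] := posterior_dichotomy s.
by rewrite esum1// => t _; rewrite p0.
Qed.

Lemma powR_prod (J : Type) (r : seq J) (F : J -> R) (e : R) :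
  (forall j, 0 <= F j) -> (\prod_(j <- r) F j) `^ e = \prod_(j <- r) F j `^ e.
Proof.
move=> F0; elim: r => [|j r IH]; first by rewrite !big_nil powR1.
by rewrite !big_cons powRM ?IH//; apply: prodr_ge0.
Qed.

(** The posterior mass is at most 1 and at most the posterior odds x against t0,
    hence at most x^eta. The exponent keeps the prior factor summable and makes
    the mean of each density ratio factor drop below 1 as soon as t and t0 have
    different laws. *)
Lemma posterior_le_powR (eta : R) t0 t s : 0 < eta -> eta < 1 -> 0 < prior t0 ->
  posterior prior f s t <=
  (prior t / prior t0) `^ eta * \prod_(z <- s) density_ratio t0 t z `^ eta.
Proof.
move=> eta0 eta1 prior0.
have rhs0 : 0 <= \prod_(z <- s) density_ratio t0 t z.
  by apply: prodr_ge0 => z _; exact: density_ratio_ge0.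
rewrite -powR_prod; last by move=> z; exact: density_ratio_ge0.
rewrite -powRM ?divr_ge0//.
set x := (X in X `^ eta); have x0 : 0 <= x by rewrite mulr_ge0 ?divr_ge0.
have := likelihood_ge0 t0 s; rewrite le_eqVlt => /predU1P[/esym lik0|lik0].
  by rewrite (posterior_eq0 _ lik0) powR_ge0.
have post1 : posterior prior f s t <= 1.
  rewrite -lee_fin (le_trans _ (esum_posterior_le1 s))//.
  by apply: (@le_esum_term _ _ t (fun t => (posterior prior f s t)%:E)) => u;
    rewrite lee_fin posterior_ge0.
have postx : posterior prior f s t <= x.
  have ev0 : prior t0 * likelihood f t0 s <= fine (evidence s).
    rewrite -lee_fin fineK//.
    apply: (@le_esum_term _ _ t0 (fun t => (prior t * likelihood f t s)%:E)) => u.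
    by rewrite lee_fin mulr_ge0 ?likelihood_ge0.
  have pl0 : 0 < prior t0 * likelihood f t0 s by exact: mulr_gt0.
  rewrite (_ : x = prior t * likelihood f t s / (prior t0 * likelihood f t0 s)).
    rewrite /posterior ler_wpM2l ?mulr_ge0 ?likelihood_ge0//.
    by rewrite lef_pV2// posrE// (lt_le_trans pl0).
  by rewrite /x prodf_div invfM mulrACA.
have [x1|x1] := leP 1 x.
  by rewrite (le_trans post1)// -(powRr0 x) ler_powR// ltW.
have [x_eq0|x_neq0] := eqVneq x 0.
  by rewrite (le_trans postx)// [leLHS]x_eq0 powR_ge0.
rewrite (le_trans postx)// ger1_powR//; last exact: ltW.
by rewrite lt_neqAle eq_sym x_neq0 x0/= ltW.
Qed.

Let gap_after_eq0 s z : (forall t, posterior prior f s t = 0) \/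
  (forall t, f t z.1 z.2 = 0) -> gap_after prior f s z = 0.
Proof.
rewrite /gap_after => -[post0|f0].
  by rewrite !pmf_mean0// ln0// oppr0 subr0.
have [post_pmf|post0] := posterior_dichotomy s; last first.
  by rewrite !pmf_mean0// ln0// oppr0 subr0.
rewrite (_ : (fun t => - ln _) = fun=> 0); last first.
  by apply/funext => t; rewrite f0 ln0// oppr0.
rewrite (_ : (fun t => f t _ _) = fun=> 0); last exact/funext.
by rewrite !pmf_mean_cst// ln0// oppr0 subr0.
Qed.

Let density_bounds t0 t z : 0 < f t0 z.1 z.2 ->
  f t0 z.1 z.2 / v <= f t z.1 z.2 <= f t0 z.1 z.2 * v.
Proof.
by move=> c0; apply/andP; split; rewrite 1?mulrC// ler_pdivrMl.
Qed.

Let log_le (a b : R) : 0 < a -> 0 < b -> ln a <= ln b + b^-1 * a - 1.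
Proof.
move=> a0 b0; have ab0 : 0 < b^-1 * a by rewrite mulr_gt0 ?invr_gt0.
have := @le_ln1Dx R (b^-1 * a - 1) ltac:(lra).
rewrite addrC subrK lnM ?posrE ?invr_gt0// lnV ?posrE//; lra.
Qed.

(** Both inequalities come from ln a <= ln b + a / b - 1: with b the posterior
    mean of the densities for the first, and with b the density at t0 for the
    logarithm of that mean in the second. *)
Let gap_after_bounds t0 s z : is_pmf (posterior prior f s) ->
  0 < f t0 z.1 z.2 ->
  0 <= gap_after prior f s z <=
    4 * v * pmf_mean (posterior prior f s) (sq_hellinger t0 ^~ z).
Proof.
move=> post_pmf c0; rewrite /gap_after; set c := f t0 z.1 z.2 in c0 *.
set p := posterior prior f s in post_pmf *.
pose g t := f t z.1 z.2; pose logg t := ln (g t).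
have gB t : c / v <= g t <= c * v by exact: density_bounds.
have cv0 : 0 < c / v by rewrite divr_gt0.
have g0 t : 0 < g t by have /andP[+ _] := gB t; exact: lt_le_trans.
have [B [gleB logB hB]] : exists B : R, [/\ forall t, `|g t| <= B,
    forall t, `|logg t| <= B & forall t, `|sq_hellinger t0 t z| <= B].
  (* Densities, logarithms and Hellinger terms need one common bound. *)
  exists (c * v + `|ln (c / v)| + `|ln (c * v)| + (v + 1)).
  have b1 := normr_ge0 (ln (c / v)); have b2 := normr_ge0 (ln (c * v)).
  have b3 : 0 < c * v by rewrite mulr_gt0.
  have b4 := v_gt0.
  split=> t.
  - by rewrite gtr0_norm//; have /andP[_ ?] := gB t; lra.
  - have /andP[gl gu] := gB t.
    have ll : ln (c / v) <= logg t by rewrite ler_ln ?posrE.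
    have lu : logg t <= ln (c * v) by rewrite ler_ln ?posrE.
    have := ler_norm (ln (c * v)); have := ler_norm (- ln (c / v)).
    rewrite normrN ler_norml => n1 n2; apply/andP; split; lra.
  - rewrite ger0_norm ?sq_hellinger_ge0//.
    by have := sq_hellinger_le t0 t z; lra.
have nlogB t : `|- logg t| <= B by rewrite normrN.
set M := pmf_mean p (fun t => f t z.1 z.2); have M0 : 0 < M.
  apply: lt_le_trans cv0 _; rewrite -(pmf_mean_cst post_pmf (c / v)).
  apply: (le_pmf_mean post_pmf (B := `|c / v| + `|B|)) => t.
  - by rewrite lerDl.
  - by rewrite (le_trans (gleB t))// (le_trans (ler_norm _))// lerDr.
  - by have /andP[] := gB t.
have MV0 : 0 <= M^-1 by rewrite invr_ge0 ltW.
have cV0 : 0 <= c^-1 by rewrite invr_ge0 ltW.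
have v40 : 0 <= 4 * v by rewrite mulr_ge0// ltW.
rewrite opprK; apply/andP; split.
  have := pmf_mean_le_affine post_pmf (lexx 0) MV0 logB gleB gleB
    (a := ln M - 1) _.
  rewrite (pmf_meanN post_pmf logB) mulVf ?gt_eqF// => H.
  suff : pmf_mean p logg + 0 * pmf_mean p g <= ln M - 1 + 1 by lra.
  by apply: H => t; have := log_le (g0 t) M0; rewrite -/(logg t); lra.
have logM := log_le M0 c0.
have := pmf_mean_le_affine post_pmf cV0 v40 nlogB gleB hB (a := 1 - ln c) _.
rewrite -/M => H.
suff : pmf_mean p (fun t => - logg t) + c^-1 * M <= 1 - ln c +
    4 * v * pmf_mean p (sq_hellinger t0 ^~ z).
  move: logM; rewrite /logg /g; lra.
apply: H => t; have := log_gap_le_hellinger (ltW v_gt1) (density_ratio_ge t c0).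
rewrite -/(sq_hellinger t0 t z) /density_ratio -/c -/(g t).
rewrite ln_div ?posrE// -/(logg t) (mulrC (g t)); lra.
Qed.

Lemma gap_after_ge0 s z : 0 <= gap_after prior f s z.
Proof.
have [t0 _] := prior_pos.
have [post_pmf|post0] := posterior_dichotomy s; last first.
  by rewrite gap_after_eq0//; left.
have [c0|c0] := ltP 0 (f t0 z.1 z.2).
  by have /andP[] := gap_after_bounds post_pmf c0.
rewrite gap_after_eq0//; right => t; apply/eqP; rewrite eq_le f_ge0 andbT.
rewrite (le_trans (ratio_bounded _ _ _ t0))// pmulr_rle0//.
Qed.

Lemma gap_after_le t0 s z : ((gap_after prior f s z)%:E <=
  (4 * v)%:E * \esum_(t in [set: Theta])
    (posterior prior f s t * sq_hellinger t0 t z)%:E)%E.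
Proof.
have rhs0 : (0 <= (4 * v)%:E * \esum_(t in [set: Theta])
    (posterior prior f s t * sq_hellinger t0 t z)%:E)%E.
  rewrite mule_ge0 ?lee_fin ?mulr_ge0 ?(ltW v_gt0)// esum_ge0// => t _.
  by rewrite lee_fin mulr_ge0 ?posterior_ge0 ?sq_hellinger_ge0.
have [post_pmf|post0] := posterior_dichotomy s; last first.
  by rewrite gap_after_eq0//; left.
have [c0|c0] := ltP 0 (f t0 z.1 z.2); last first.
  rewrite gap_after_eq0//; right => t; apply/eqP; rewrite eq_le f_ge0 andbT.
  by rewrite (le_trans (ratio_bounded _ _ _ t0))// pmulr_rle0.
rewrite -(pmf_mean_ge0E post_pmf (B := v + 1)) => [|t]; last first.
  by rewrite sq_hellinger_ge0 sq_hellinger_le.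
by rewrite -EFinM lee_fin; have /andP[] := gap_after_bounds post_pmf c0.
Qed.

(** For the first observation, where there is no past on which the posterior
    could concentrate. *)
Lemma gap_after_le_cst s z : gap_after prior f s z <= 4 * v * (v + 1).
Proof.
have [t0 _] := prior_pos.
rewrite -lee_fin (le_trans (gap_after_le t0 s z))// [leRHS]EFinM.
rewrite lee_wpmul2l ?lee_fin ?mulr_ge0 ?(ltW v_gt0)//.
apply: (@le_trans _ _ (\esum_(t in [set: Theta])
    ((v + 1)%:E * (posterior prior f s t)%:E))%E).
  apply: le_esum => t _; rewrite -EFinM lee_fin mulrC.
  by rewrite ler_wpM2r ?posterior_ge0 ?sq_hellinger_le.
have v1 : 0 <= v + 1 by rewrite addr_ge0// ltW.
rewrite esumZ//; last by move=> t; rewrite lee_fin posterior_ge0.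
by rewrite -[leRHS]mule1 lee_wpmul2l ?lee_fin// esum_posterior_le1.
Qed.

End posterior_bounds.

(** * Measurability of the gap *)

Section measurability.
Context {R : realType} d (W : measurableType d).

Lemma measurable_div_ge0 (a b : W -> R) : (forall x, 0 <= b x) ->
  measurable_fun [set: W] a -> measurable_fun [set: W] b ->
  measurable_fun [set: W] (fun x => a x / b x).
Proof.
move=> b0 ma mb.
rewrite (_ : (fun x => _) = fun x => a x * b x `^ (-1)).
  apply: measurable_funM => //.
  exact: (measurableT_comp (measurable_powR (-1)) mb).
by apply/funext => x; rewrite powR_inv1.
Qed.

Lemma measurable_pmf_mean (I : countType) (p g : I -> W -> R) :
  (forall t, measurable_fun [set: W] (p t)) ->
  (forall t, measurable_fun [set: W] (g t)) ->
  measurable_fun [set: W] (fun x => pmf_mean (p^~ x) (g^~ x)).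
Proof.
move=> mp mg; apply: (measurableT_comp (@fine_measurable R setT measurableT)).
apply: emeasurable_funB; apply: measurable_esum => t.
- apply/measurable_EFinP/measurable_maxr => //; exact: measurable_funM.
- by move=> x; rewrite lee_fin le_max lexx orbT.
- apply/measurable_EFinP/measurable_maxr => //.
  by apply: measurable_funN; exact: measurable_funM.
- by move=> x; rewrite lee_fin le_max lexx orbT.
Qed.

End measurability.

Section measurable_gap.
Context d d' (X : measurableType d) (Y : measurableType d') (R : realType).
Context (Theta : countType).
Variables (PX : probability X R) (mu : {measure set Y -> \bar R}).
Variables (P : Theta -> R.-pker X ~> Y) (f : Theta -> X -> Y -> R).
Hypothesis f_density : forall t, is_cond_density mu (P t) (f t).
Variables (prior : Theta -> R) (v : R).
Hypotheses (prior_pmf : is_pmf prior) (v_gt1 : 1 < v).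
Hypothesis ratio_bounded : forall x y t t', f t x y <= v * f t' x y.
Implicit Types (t u : Theta) (z : X * Y).

Let f_ge0 t x y : 0 <= f t x y. Proof. by have [] := f_density t. Qed.

Let mf t : measurable_fun [set: X * Y] (fun z => f t z.1 z.2).
Proof. by have [] := f_density t. Qed.

Lemma measurable_density_ratio t0 t :
  measurable_fun [set: X * Y] (density_ratio f t0 t).
Proof. exact: measurable_div_ge0. Qed.

Lemma measurable_sq_hellinger t0 t :
  measurable_fun [set: X * Y] (sq_hellinger f t0 t).
Proof.
apply: measurable_funX; apply: measurable_funB => //.
apply: (measurableT_comp _ (measurable_density_ratio t0 t)).
exact: continuous_measurable_fun (@sqrt_continuous R).
Qed.

Lemma seq_measurable_likelihood t :
  seq_measurable (fun s => (likelihood f t s)%:E).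
Proof.
exact: (seq_measurable_prod (mf t)).
Qed.

Let prior_ge0 t : 0 <= prior t. Proof. by have [] := prior_pmf. Qed.

Let lik_ge0 t s : 0 <= likelihood f t s.
Proof. exact: likelihood_ge0. Qed.

Lemma seq_measurable_posterior t :
  seq_measurable (fun s => (posterior prior f s t)%:E).
Proof.
move=> n; apply/measurable_EFinP.
have mlik u : measurable_fun [set: n.-tuple (X * Y)] (fun s => likelihood f u s).
  by apply/measurable_EFinP; exact: seq_measurable_likelihood.
apply: measurable_div_ge0.
- move=> s; apply: fine_ge0; apply: esum_ge0 => u _.
  by rewrite lee_fin mulr_ge0.
- by apply: measurable_funM.
- apply: (measurableT_comp (@fine_measurable R setT measurableT)).
  apply: measurable_esum => [u|u s]; last by rewrite lee_fin mulr_ge0.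
  by apply/measurable_EFinP; apply: measurable_funM.
Qed.

Lemma mix_gap_take n (i : 'I_n) (s : n.-tuple (X * Y)) :
  mix_gap prior f (take i.+1 s) = gap_after prior f (take i s) (tnth s i).
Proof.
have z0 := tnth s i; rewrite (take_nth z0) ?size_tuple// -tnth_nth.
rewrite /mix_gap; case: (take i s) => [//|z s'].
by rewrite rcons_cons belast_rcons last_rcons.
Qed.

Lemma measurable_mix_gap_take n (i : 'I_n) :
  measurable_fun [set: n.-tuple (X * Y)] (fun s => mix_gap prior f (take i.+1 s)).
Proof.
under eq_fun do rewrite mix_gap_take.
have mft t : measurable_fun [set: n.-tuple (X * Y)]
    (fun s => f t (tnth s i).1 (tnth s i).2).
  exact: measurableT_comp (mf t) (measurable_tnth i).
have mpost t : measurable_fun [set: n.-tuple (X * Y)]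
    (fun s => posterior prior f (take i s) t).
  by apply/measurable_EFinP; exact: (seq_measurable_take i (seq_measurable_posterior t)).
apply: measurable_funB.
  apply: (measurable_pmf_mean
      (p := fun t (s : n.-tuple (X * Y)) => posterior prior f (take i s) t)
      (g := fun t s => - ln (f t (tnth s i).1 (tnth s i).2))) => // t.
  by apply: measurable_funN; exact: measurableT_comp.
apply: measurable_funN; apply: measurableT_comp => //.
exact: (measurable_pmf_mean
    (p := fun t (s : n.-tuple (X * Y)) => posterior prior f (take i s) t)
    (g := fun t s => f t (tnth s i).1 (tnth s i).2)).
Qed.

(** Integrating f_t / f_t0 against f_t0 gives the integral of f_t over the
    points where f_t0 does not vanish. *)
Lemma integral_density_ratio_le1 t0 t :
  (\int[pair_law PX (P t0)]_z (density_ratio f t0 t z)%:E <= 1)%E.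
Proof.
have r0 z : (0 <= (density_ratio f t0 t z)%:E)%E.
  by rewrite lee_fin density_ratio_ge0.
have mr : measurable_fun [set: X * Y] (EFin \o density_ratio f t0 t).
  by apply/measurable_EFinP; exact: measurable_density_ratio.
have mpairE (h : X * Y -> R) x : measurable_fun [set: X * Y] h ->
    measurable_fun [set: Y] (fun y => h (x, y)).
  by move=> mh; exact: measurableT_comp.
rewrite integral_pair_law//.
rewrite -(integral_prob_cst PX 1%E); apply: ge0_le_integral => //.
- by move=> x _; apply: integral_ge0 => y _; exact: r0.
- exact: (measurable_fun_integral_finite_kernel
    (fun z => (density_ratio f t0 t z)%:E) (P t0)).
- move=> x _; have [_ _ kE] := f_density t0; have [_ _ kE'] := f_density t.
  have mft0 := mpairE (fun z => f t0 z.1 z.2) x (mf t0).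
  have mrx : measurable_fun [set: Y] (fun y => (density_ratio f t0 t (x, y))%:E).
    apply/measurable_EFinP; apply: (mpairE (density_ratio f t0 t)).
    exact: measurable_density_ratio.
  rewrite (integral_density mft0 (f_ge0 t0 x) (kE x) mrx)//.
  have <- : P t x setT = 1%E by exact: prob_kernel.
  rewrite kE'//; apply: ge0_le_integral => //.
  + by move=> y _; rewrite mule_ge0 ?lee_fin ?density_ratio_ge0.
  + by apply: emeasurable_funM => //; exact/measurable_EFinP.
  + by apply/measurable_EFinP; exact: (mpairE (fun z => f t z.1 z.2)).
  + move=> y _; rewrite -EFinM lee_fin /density_ratio/=.
    have [->|ft0] := eqVneq (f t0 x y) 0; first by rewrite mulr0.
    by rewrite divfK.
Qed.

End measurable_gap.

(** * The expected gap under a fixed true parameter *)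

Section expected_gap_bound.
Context d d' (X : measurableType d) (Y : measurableType d') (R : realType).
Context (Theta : countType).
Variables (PX : probability X R) (mu : {measure set Y -> \bar R}).
Variables (P : Theta -> R.-pker X ~> Y) (f : Theta -> X -> Y -> R).
Hypothesis f_density : forall t, is_cond_density mu (P t) (f t).
Variables (prior : Theta -> R) (v : R).
Hypotheses (prior_pmf : is_pmf prior) (v_gt1 : 1 < v).
Hypothesis ratio_bounded : forall x y t t', f t x y <= v * f t' x y.
Variable eta : R.
Hypotheses (eta_gt0 : 0 < eta) (eta_lt1 : eta < 1).
Implicit Types (t u : Theta) (z : X * Y).

Let f_ge0 t x y : 0 <= f t x y. Proof. by have [] := f_density t. Qed.

Let prior_ge0 t : 0 <= prior t. Proof. by have [] := prior_pmf. Qed.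

Let kappa : R := Num.min eta (1 - eta).

Let kappa_gt0 : 0 < kappa.
Proof. by rewrite /kappa lt_min eta_gt0 subr_gt0. Qed.

Let measurable_powR_ratio t0 t :
  measurable_fun [set: X * Y] (fun z => density_ratio f t0 t z `^ eta).
Proof.
exact: (measurableT_comp (measurable_powR eta)
  (measurable_density_ratio f_density t0 t)).
Qed.

(** The first integral is the Hellinger integral of order eta, the second the
    squared Hellinger distance. The inequality integrates
    powR_add_hellinger, whose linear term eta (r - 1) has nonpositive mean. *)
Lemma affinity_hellinger t0 t : exists a b : R,
  [/\ (\int[pair_law PX (P t0)]_z (density_ratio f t0 t z `^ eta)%:E = a%:E)%E,
      (\int[pair_law PX (P t0)]_z (sq_hellinger f t0 t z)%:E = b%:E)%E,
      0 <= a, 0 <= b <= v + 1 & a + kappa * b <= 1].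
Proof.
set Q := pair_law PX (P t0).
set A := (\int[Q]_z (density_ratio f t0 t z `^ eta)%:E)%E.
set B := (\int[Q]_z (sq_hellinger f t0 t z)%:E)%E.
have mpow : measurable_fun [set: X * Y]
    (fun z => (density_ratio f t0 t z `^ eta)%:E).
  by apply/measurable_EFinP; exact: measurable_powR_ratio.
have mhell : measurable_fun [set: X * Y] (fun z => (sq_hellinger f t0 t z)%:E).
  by apply/measurable_EFinP; exact: (measurable_sq_hellinger f_density).
have mratio : measurable_fun [set: X * Y] (fun z => (density_ratio f t0 t z)%:E).
  by apply/measurable_EFinP; exact: (measurable_density_ratio f_density).
have r0 z := density_ratio_ge0 f_ge0 t0 t z.
have h0 z := sq_hellinger_ge0 f t0 t z.
have A0 : (0 <= A)%E by apply: integral_ge0 => z _; rewrite lee_fin powR_ge0.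
have B0 : (0 <= B)%E by apply: integral_ge0 => z _; rewrite lee_fin.
have Bv : (B <= (v + 1)%:E)%E.
  rewrite -(integral_prob_cst Q (v + 1)%:E); apply: ge0_le_integral => //.
  - by move=> z _; rewrite lee_fin.
  - by move=> z _; rewrite lee_fin (sq_hellinger_le v_gt1 f_ge0 ratio_bounded).
have mkhell : measurable_fun [set: X * Y]
    (fun z => (kappa%:E * (sq_hellinger f t0 t z)%:E)%E).
  exact: measurable_funeM.
have meratio : measurable_fun [set: X * Y]
    (fun z => (eta%:E * (density_ratio f t0 t z)%:E)%E).
  exact: measurable_funeM.
have sum_le : (A + kappa%:E * B + eta%:E <= 1 + eta%:E)%E.
  have lhsE : (A + kappa%:E * B + eta%:E = \int[Q]_z
      ((density_ratio f t0 t z `^ eta)%:E +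
        kappa%:E * (sq_hellinger f t0 t z)%:E + eta%:E))%E.
    rewrite ge0_integralD//; last 3 first.
    - by move=> z _; rewrite adde_ge0 ?mule_ge0 ?lee_fin ?powR_ge0 ?(ltW kappa_gt0).
    - exact: emeasurable_funD.
    - by move=> z _; rewrite lee_fin ltW.
    rewrite integral_prob_cst; congr (_ + _)%E.
    rewrite ge0_integralD//; last 2 first.
    - by move=> z _; rewrite lee_fin powR_ge0.
    - by move=> z _; rewrite mule_ge0 ?lee_fin ?(ltW kappa_gt0).
    congr (_ + _)%E; rewrite ge0_integralZl//; last by rewrite lee_fin ltW.
    by move=> z _; rewrite lee_fin.
  rewrite lhsE; apply: (@le_trans _ _
      (\int[Q]_z (1 + eta%:E * (density_ratio f t0 t z)%:E))%E).
    apply: ge0_le_integral => //.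
    - by move=> z _; rewrite !adde_ge0 ?mule_ge0 ?lee_fin ?powR_ge0
        ?(ltW kappa_gt0) ?(ltW eta_gt0).
    - by apply: emeasurable_funD => //; exact: emeasurable_funD.
    - exact: emeasurable_funD.
    - move=> z _; rewrite -!EFinM -!EFinD lee_fin.
      by have := powR_add_hellinger (r0 z) eta_gt0 eta_lt1;
        rewrite -/(sq_hellinger f t0 t z) -/kappa; lra.
  rewrite ge0_integralD//; last first.
    by move=> z _; rewrite mule_ge0 ?lee_fin ?(ltW eta_gt0).
  rewrite integral_prob_cst ge0_integralZl//; last 2 first.
  - by move=> z _; rewrite lee_fin.
  - by rewrite lee_fin ltW.
  rewrite leeD2l// -[leRHS]mule1 lee_wpmul2l ?lee_fin ?(ltW eta_gt0)//.
  exact: integral_density_ratio_le1.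
have Bfin : B \is a fin_num by rewrite ge0_fin_numE// (le_lt_trans Bv)// ltry.
have kB0 : (0 <= kappa%:E * B)%E by rewrite mule_ge0// lee_fin ltW.
have Afin : A \is a fin_num.
  rewrite ge0_fin_numE// (@le_lt_trans _ _ (1 + eta%:E)%E)// -?EFinD ?ltry//.
  by apply: le_trans sum_le; rewrite -addeA leeDl// adde_ge0// lee_fin ltW.
exists (fine A), (fine B); split; rewrite ?fineK ?fine_ge0//=.
  by rewrite -lee_fin fineK.
move: sum_le; rewrite -(fineK Afin) -(fineK Bfin) -EFinM -!EFinD lee_fin.
lra.
Qed.

(** The bound splits the parameters into those at squared Hellinger distance at
    most eps, weighted by a posterior of mass at most 1, and those farther away,
    whose expected posterior mass decays exponentially in i. *)
Lemma expected_gap_after_le t0 (S : R) n (i : 'I_n) (eps : R) :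
  0 < prior t0 -> 0 <= eps ->
  (\esum_(t in [set: Theta]) (prior t `^ eta)%:E = S%:E)%E ->
  (\int[iid_law (pair_law PX (P t0)) n]_s (mix_gap prior f (take i.+1 s))%:E <=
   (4 * v * (eps + (v + 1) * expR (- (kappa * eps * i%:R)) *
     (prior t0 `^ (- eta) * S)))%:E)%E.
Proof.
move=> prior0 eps0 SE; set Q := pair_law PX (P t0).
have v0 : 0 < v by exact: lt_trans v_gt1.
have post0 s t := posterior_ge0 prior_pmf v_gt1 f_ge0 ratio_bounded s t.
pose E t := (\int[iid_law Q n]_s (posterior prior f (take i s) t)%:E)%E.
have E0 t : (0 <= E t)%E by apply: integral_ge0 => s _; rewrite lee_fin.
have mpost t : measurable_fun [set: n.-tuple (X * Y)]
    (fun s => (posterior prior f (take i s) t)%:E).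
  exact: (seq_measurable_take i (seq_measurable_posterior f_density prior_pmf t)).
have mhell t : measurable_fun [set: X * Y] (fun z => (sq_hellinger f t0 t z)%:E).
  by apply/measurable_EFinP; exact: (measurable_sq_hellinger f_density).
have mhelli t : measurable_fun [set: n.-tuple (X * Y)]
    (fun s => (sq_hellinger f t0 t (tnth s i))%:E).
  exact: measurableT_comp (mhell t) (measurable_tnth i).
have sumE : (\esum_(t in [set: Theta]) E t <= 1)%E.
  rewrite -integral_esum//; last by move=> t s; rewrite lee_fin.
  rewrite -(integral_prob_cst (iid_law Q n) 1%E); apply: ge0_le_integral => //.
  - by move=> s _; apply: esum_ge0 => t _; rewrite lee_fin.
  - by apply: measurable_esum => // t s; rewrite lee_fin.
  - by move=> s _; exact: (esum_posterior_le1 prior_pmf v_gt1 f_ge0 ratio_bounded).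
pose w t := (prior t / prior t0) `^ eta.
have w0 t : 0 <= w t by exact: powR_ge0.
have term t : (E t * \int[Q]_z (sq_hellinger f t0 t z)%:E <=
    eps%:E * E t + ((v + 1) * expR (- (kappa * eps * i%:R)) * w t)%:E)%E.
  have [a [b [aE bE a0 /andP[b0 bv] ab]]] := affinity_hellinger t0 t.
  rewrite bE; have [beps|epsb] := leP b eps.
    rewrite -[leLHS]adde0 leeD//; first by rewrite muleC lee_wpmul2r// lee_fin.
    by rewrite lee_fin !mulr_ge0 ?expR_ge0// addr_ge0// ltW.
  have aexp : a <= expR (- (kappa * b)).
    by have := expR_ge1Dx (- (kappa * b)); lra.
  have Eexp : (E t <= (w t * expR (- (kappa * eps * i%:R)))%:E)%E.
    apply: (@le_trans _ _ (w t * a ^+ i)%:E); last first.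
      rewrite lee_fin ler_wpM2l// (@le_trans _ _ (expR (- (kappa * b)) ^+ i))//.
        by rewrite lerXn2r// nnegrE ?expR_ge0.
      rewrite -expRM_natr ler_expR mulNr lerN2 ler_wpM2r//.
      by rewrite ler_wpM2l ?ltW.
    rewrite EFinM -(integral_iid_law_prod (ltnW (ltn_ord i))
      (measurable_powR_ratio t0 t) (fun z => powR_ge0 _ _) aE).
    have mprod : measurable_fun [set: n.-tuple (X * Y)]
        (fun s => (\prod_(z <- take i s) density_ratio f t0 t z `^ eta)%:E).
      exact: (seq_measurable_take i (seq_measurable_prod (measurable_powR_ratio t0 t))).
    rewrite -ge0_integralZl ?lee_fin//; last first.
      by move=> s _; rewrite lee_fin prodr_ge0// => z _; exact: powR_ge0.
    apply: ge0_le_integral => //.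
    - by move=> s _; rewrite lee_fin.
    - exact: measurable_funeM.
    - move=> s _; rewrite -EFinM lee_fin.
      exact: (posterior_le_powR prior_pmf v_gt1 f_ge0 ratio_bounded).
  rewrite -[leLHS]add0e leeD ?mule_ge0 ?lee_fin//.
  apply: (@le_trans _ _ ((w t * expR (- (kappa * eps * i%:R)))%:E * b%:E)%E).
    by rewrite lee_wpmul2r// lee_fin.
  rewrite -EFinM lee_fin mulrC (mulrC (w t)) -[leRHS]mulrA.
  by rewrite ler_wpM2r// mulr_ge0// expR_ge0.
have v40 : 0 <= 4 * v by rewrite mulr_ge0// ltW.
apply: (@le_trans _ _ (\int[iid_law Q n]_s ((4 * v)%:E *
    \esum_(t in [set: Theta]) ((posterior prior f (take i s) t)%:E *
      (sq_hellinger f t0 t (tnth s i))%:E)))%E).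
  have mterm t : measurable_fun [set: n.-tuple (X * Y)]
      (fun s => ((posterior prior f (take i s) t)%:E *
        (sq_hellinger f t0 t (tnth s i))%:E)%E).
    exact: emeasurable_funM.
  apply: ge0_le_integral => //.
  - move=> s _; rewrite lee_fin mix_gap_take.
    exact: (gap_after_ge0 prior_pmf v_gt1 f_ge0 ratio_bounded).
  - apply/measurable_EFinP.
    exact: (measurable_mix_gap_take f_density prior_pmf).
  - apply: measurable_funeM; apply: measurable_esum => // t s.
    by rewrite mule_ge0// lee_fin ?sq_hellinger_ge0.
  - move=> s _; rewrite mix_gap_take.
    exact: (gap_after_le prior_pmf v_gt1 f_ge0 ratio_bounded).
have mterm t : measurable_fun [set: n.-tuple (X * Y)]
    (fun s => ((posterior prior f (take i s) t)%:E *
      (sq_hellinger f t0 t (tnth s i))%:E)%E).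
  exact: emeasurable_funM.
have term0 t (s : n.-tuple (X * Y)) : (0 <= (posterior prior f (take i s) t)%:E *
    (sq_hellinger f t0 t (tnth s i))%:E)%E.
  by rewrite mule_ge0// lee_fin ?sq_hellinger_ge0.
rewrite ge0_integralZl//; last 2 first.
- exact: measurable_esum.
- by move=> s _; exact: esum_ge0.
rewrite integral_esum// [leRHS]EFinM lee_wpmul2l ?lee_fin//.
apply: (@le_trans _ _ (\esum_(t in [set: Theta]) (eps%:E * E t +
    ((v + 1) * expR (- (kappa * eps * i%:R)) * w t)%:E))%E).
  apply: le_esum => t _; apply: le_trans (term t).
  rewrite (integral_iid_law_past_present Q i
    (A := fun s => (posterior prior f s t)%:E)
    (g := fun z => (sq_hellinger f t0 t z)%:E))//.
  - exact: (seq_measurable_posterior f_density prior_pmf).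
  - by move=> s; rewrite lee_fin.
  - by move=> z; rewrite lee_fin sq_hellinger_ge0.
have c0 : 0 <= (v + 1) * expR (- (kappa * eps * i%:R)).
  by rewrite mulr_ge0 ?expR_ge0// addr_ge0// ltW.
rewrite esumD; last 2 first.
- by move=> t _; rewrite mule_ge0// lee_fin.
- by move=> t _; rewrite lee_fin mulr_ge0.
rewrite EFinD leeD//.
  by rewrite esumZ// -[leRHS]mule1 lee_wpmul2l// lee_fin.
have wE t : w t = prior t0 `^ (- eta) * prior t `^ eta.
  rewrite /w powRM ?invr_ge0// mulrC; congr (_ * _).
  by rewrite -powR_inv1// -powRrM mulN1r.
under eq_esum do rewrite wE mulrA EFinM.
rewrite esumZ; last 2 first.
- by rewrite mulr_ge0// powR_ge0.
- by move=> t; rewrite lee_fin powR_ge0.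
by rewrite SE -EFinM mulrA.
Qed.

End expected_gap_bound.

(** * The joint Bayesian law *)

Section bayes_joint.
Context d d' (X : measurableType d) (Y : measurableType d') (R : realType).
Context (Theta : countType).
Variables (PX : probability X R) (P : Theta -> R.-pker X ~> Y).
Variables (prior : Theta -> R) (eta S : R).
Hypotheses (prior_pmf : is_pmf prior) (eta_gt0 : 0 < eta) (eta_lt1 : eta < 1).
Hypothesis prior_eta : (\esum_(t in [set: Theta]) (prior t `^ eta)%:E = S%:E)%E.
Context dO (Omega : measurableType dO) (Pi : probability Omega R).
Variables (thetastar : Omega -> Theta) (Z : nat -> Omega -> X * Y).
Hypothesis bayes : is_bayes_joint prior PX P Pi thetastar Z.

Let prior_ge0 t : 0 <= prior t. Proof. by have [] := prior_pmf. Qed.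

Lemma measurable_sample n : measurable_fun [set: Omega] (sample Z n).
Proof.
have [_ mZ _] := bayes; apply/measurable_fun_tnthP => i.
by rewrite (_ : _ \o _ = Z i)//; apply/funext => w /=; rewrite tnth_mktuple.
Qed.

Lemma bayes_joint_le_esum n (B : Theta -> set (n.-tuple (X * Y))) :
  (forall t, measurable (B t)) ->
  (Pi [set w | B (thetastar w) (sample Z n w)] <=
   \esum_(t in [set: Theta])
     ((prior t)%:E * iid_law (pair_law PX (P t)) n (B t)))%E.
Proof.
move=> mB; have [mtheta _ lawE] := bayes.
pose F t := [set w | thetastar w = t /\ B t (sample Z n w)].
have mF t : measurable (F t).
  rewrite (_ : F t = thetastar @^-1` [set t] `&` sample Z n @^-1` B t)//.
  apply: measurableI; first exact: mtheta.
  by rewrite -[X in measurable X]setTI; exact: measurable_sample.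
pose G k := oapp F set0 (@pickle_inv Theta k).
have mG k : measurable (G k) by rewrite /G; case: pickle_inv => [t|]/=.
have EG : [set w | B (thetastar w) (sample Z n w)] = \bigcup_k G k.
  apply/seteqP; split=> [w Bw|w [k _]].
    by exists (pickle (thetastar w)) => //; rewrite /G pickleK_inv.
  by rewrite /G; case: pickle_inv => [t|//] [<-].
rewrite EG esum_pickle => [|t]; last by rewrite mule_ge0// lee_fin.
apply: (@le_trans _ _ (\sum_(k <oo) Pi (G k))%E).
  apply: measure_sigma_subadditive => //; exact: bigcup_measurable.
apply: lee_nneseries => // k _; rewrite /G; case: pickle_inv => [t|]/=.
  by rewrite /F lawE.
by rewrite measure0.
Qed.

(** The parameters with prior mass p <= tau are discarded: each has
    p <= p^eta tau^(1 - eta), which is summable. The others satisfy the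
    conditional bound q. *)
Lemma bayes_joint_tail n (B : Theta -> set (n.-tuple (X * Y))) (tau q : R) :
  (forall t, measurable (B t)) -> 0 < tau -> 0 <= q ->
  (forall t, tau < prior t ->
     (iid_law (pair_law PX (P t)) n (B t) <= q%:E)%E) ->
  (Pi [set w | B (thetastar w) (sample Z n w)] <=
     (S * tau `^ (1 - eta) + q)%:E)%E.
Proof.
move=> mB tau0 q0 Bq; apply: le_trans (bayes_joint_le_esum mB) _.
apply: (@le_trans _ _ (\esum_(t in [set: Theta])
    ((tau `^ (1 - eta))%:E * (prior t `^ eta)%:E + q%:E * (prior t)%:E))%E).
  apply: le_esum => t _; have [small|large] := leP (prior t) tau.
    apply: (@le_trans _ _ (prior t)%:E).
      rewrite -[leRHS]mule1 lee_wpmul2l ?lee_fin//; exact: probability_le1.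
    rewrite -!EFinM lee_fin -[leLHS]addr0 lerD ?mulr_ge0//.
    have [->|p0] := eqVneq (prior t) 0; first by rewrite mulr_ge0 ?powR_ge0.
    rewrite -{1}(powRr1 (prior_ge0 t)) -[in leLHS](subrK eta 1) powRD ?p0 ?implybT//.
    rewrite ler_wpM2r ?powR_ge0//.
    by apply: ge0_ler_powR; rewrite ?nnegrE ?subr_ge0// ltW.
  rewrite -[leLHS]add0e leeD ?lee_fin ?mulr_ge0 ?powR_ge0//.
  by rewrite muleC lee_wpmul2r ?lee_fin// Bq.
rewrite esumD; last 2 first.
- by move=> t _; rewrite -EFinM lee_fin mulr_ge0 ?powR_ge0.
- by move=> t _; rewrite -EFinM lee_fin mulr_ge0.
have pow0 t : (0 <= (prior t `^ eta)%:E)%E by rewrite lee_fin powR_ge0.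
rewrite !esumZ ?powR_ge0//; have [_ ->] := prior_pmf.
by rewrite prior_eta mule1 -EFinM -EFinD lee_fin mulrC.
Qed.

End bayes_joint.

(** * Rates for parameters that are not too improbable a priori *)

(** Each increment 1/(x+1) is at most ln (x+1) - ln x. *)
Lemma harmonic_le_ln (R : realType) (n : nat) :
  \sum_(i < n.+1) (i.+1%:R^-1 : R) <= 1 + ln n.+1%:R.
Proof.
elim: n => [|n IH]; first by rewrite big_ord1 ln1 addr0 invr1.
rewrite big_ord_recr/=; apply: le_trans (lerD IH (lexx _)) _.
rewrite -addrA lerD2l.
have x0 : 0 < n.+1%:R :> R by rewrite ltr0n.
rewrite -(natr1 n.+1); move: (n.+1%:R : R) x0 => x x0.
have x1 : 0 < x + 1 by rewrite addr_gt0.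
have q0 : 0 < x / (x + 1) by rewrite divr_gt0.
have qE : x / (x + 1) = 1 - (x + 1)^-1.
  by rewrite -{1}(addrK 1 x) mulrBl mulfV ?gt_eqF// mul1r.
have := @le_ln1Dx R (x / (x + 1) - 1) ltac:(lra).
rewrite addrCA subrr addr0 ln_div ?posrE// qE; lra.
Qed.

Section gap_rates.
Context d d' (X : measurableType d) (Y : measurableType d') (R : realType).
Context (Theta : countType).
Variables (PX : probability X R) (mu : {measure set Y -> \bar R}).
Variables (P : Theta -> R.-pker X ~> Y) (f : Theta -> X -> Y -> R).
Hypothesis f_density : forall t, is_cond_density mu (P t) (f t).
Variables (prior : Theta -> R) (v : R).
Hypotheses (prior_pmf : is_pmf prior) (v_gt1 : 1 < v).
Hypothesis ratio_bounded : forall x y t t', f t x y <= v * f t' x y.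
Variables (eta S : R).
Hypotheses (eta_gt0 : 0 < eta) (eta_lt1 : eta < 1).
Hypothesis prior_eta : (\esum_(t in [set: Theta]) (prior t `^ eta)%:E = S%:E)%E.

Let f_ge0 t x y : 0 <= f t x y. Proof. by have [] := f_density t. Qed.

Let prior_ge0 t : 0 <= prior t. Proof. by have [] := prior_pmf. Qed.

Let S_ge0 : 0 <= S.
Proof.
by rewrite -lee_fin -prior_eta esum_ge0// => t _; rewrite lee_fin powR_ge0.
Qed.

Let v_gt0 : 0 < v. Proof. exact: lt_trans v_gt1. Qed.

Let ln2_gt0 : 0 < ln 2 :> R. Proof. by rewrite ln_gt0// ltr1n. Qed.

Let ln2_le n : (1 < n)%N -> ln 2 <= ln n%:R :> R.
Proof. by move=> n1; rewrite ler_ln ?posrE ?ltr0n ?ler_nat//; exact: ltnW. Qed.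

Lemma mix_gap_ge0 s : 0 <= mix_gap prior f s.
Proof. by case: s => //= z s; exact: (gap_after_ge0 _ v_gt1). Qed.

Lemma mix_gap_le_cst s : mix_gap prior f s <= 4 * v * (v + 1).
Proof.
case: s => [|z s] /=; last exact: (gap_after_le_cst prior_pmf v_gt1).
by rewrite !mulr_ge0// ?addr_ge0// ltW.
Qed.

Lemma cumulative_gap_tuple n (s : n.-tuple (X * Y)) :
  cumulative_gap prior f s = \sum_(i < n) mix_gap prior f (take i.+1 s).
Proof. by rewrite /cumulative_gap size_tuple big_add1/= big_mkord. Qed.

(** The threshold eps = A ln n / (i + 1) makes the exponential at most
    n^(- alpha eta - 1), which beats the factor n^(alpha eta) coming from the
    prior mass of the true parameter. *)
Lemma expected_gap_rate (alpha : R) : 0 <= alpha ->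
  exists2 C : R, 0 <= C & forall n (i : 'I_n) t0, (1 < n)%N ->
    n%:R `^ (- alpha) < prior t0 ->
    (\int[iid_law (pair_law PX (P t0)) n]_s (mix_gap prior f (take i.+1 s))%:E
      <= (C * (ln n%:R / i.+1%:R))%:E)%E.
Proof.
move=> alpha0; set kappa := Num.min eta (1 - eta).
have kappa0 : 0 < kappa by rewrite lt_min eta_gt0 subr_gt0.
pose G := 4 * v * (v + 1).
have G0 : 0 <= G by rewrite !mulr_ge0// ?addr_ge0// ltW.
(* The factor 2 compensates i / (i + 1) >= 1/2 in the exponent. *)
pose A := 2 * (alpha * eta + 1) / kappa.
have ae0 : 0 <= alpha * eta by rewrite mulr_ge0// ltW.
have A0 : 0 <= A by rewrite divr_ge0 ?(ltW kappa0)//; lra.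
pose C := 4 * v * (A + (v + 1) * S / ln 2) + G / ln 2.
have C1 : 0 <= 4 * v * (A + (v + 1) * S / ln 2).
  rewrite !mulr_ge0// ?(ltW v_gt0)// addr_ge0// divr_ge0 ?(ltW ln2_gt0)//.
  by rewrite mulr_ge0// addr_ge0// ltW.
have C2 : 0 <= G / ln 2 by rewrite divr_ge0// ltW.
exists C => [|n i t0 n1 prior_large]; first exact: addr_ge0.
set L := ln n%:R; have L2 : ln 2 <= L by exact: ln2_le.
have L0 : 0 < L by exact: lt_le_trans L2.
have n0 : 0 < n%:R :> R by rewrite ltr0n ltnW.
have prior0 : 0 < prior t0 by apply: le_lt_trans prior_large; exact: powR_ge0.
have i0 : 0 < i.+1%:R :> R by rewrite ltr0n.
have Li0 : 0 <= L / i.+1%:R by rewrite divr_ge0// ltW.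
have ln2V : 1 <= L / ln 2 by rewrite ler_pdivlMr// mul1r.
have mgap : measurable_fun [set: n.-tuple (X * Y)]
    (fun s => (mix_gap prior f (take i.+1 s))%:E).
  by apply/measurable_EFinP; exact: (measurable_mix_gap_take f_density prior_pmf).
(* With no past observation, only the uniform bound is available; it is
   absorbed by ln n >= ln 2. *)
have [iz|i_gt0] := posnP i.
  apply: (@le_trans _ _ G%:E).
    rewrite -(integral_prob_cst (iid_law (pair_law PX (P t0)) n) G%:E).
    apply: ge0_le_integral => //.
    - by move=> s _; rewrite lee_fin mix_gap_ge0.
    - by move=> s _; rewrite lee_fin mix_gap_le_cst.
  rewrite lee_fin iz invr1 mulr1 /C mulrDl.
  apply: (@le_trans _ _ (G / ln 2 * L)); last by rewrite lerDr mulr_ge0// ltW.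
  by rewrite -mulrA (mulrC _ L) ler_peMr.
pose eps := A * (L / i.+1%:R).
have eps0 : 0 <= eps by exact: mulr_ge0.
apply: le_trans (expected_gap_after_le PX f_density prior_pmf v_gt1 ratio_bounded
  eta_gt0 eta_lt1 i prior0 eps0 prior_eta) _.
rewrite lee_fin -/kappa.
have prior_pow : prior t0 `^ (- eta) <= expR (alpha * eta * L).
  rewrite powRN (_ : expR _ = ((n%:R `^ (- alpha)) `^ eta)^-1).
    rewrite lef_pV2 ?posrE ?powR_gt0//.
    by apply: ge0_ler_powR; rewrite ?nnegrE ?powR_ge0 ?(ltW eta_gt0)// ltW.
  rewrite -powRrM -powRN mulNr opprK /powR gt_eqF//.
have decay : expR (- (kappa * eps * i%:R)) <= expR (- (alpha * eta + 1) * L).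
  rewrite ler_expR mulNr lerN2.
  have -> : kappa * eps * i%:R = (alpha * eta + 1) * L * (2 * i%:R / i.+1%:R).
    by rewrite /eps /A; field; rewrite !gt_eqF// nat1r.
  rewrite ler_peMr ?mulr_ge0 ?(ltW L0) ?addr_ge0//.
  rewrite ler_pdivlMr// mul1r -natrM ler_nat mul2n -addnn -addn1.
  by rewrite leq_add2l.
have rem : expR (- (kappa * eps * i%:R)) * prior t0 `^ (- eta) <=
    L / i.+1%:R / ln 2.
  apply: (@le_trans _ _ (n%:R^-1)).
    have -> : n%:R^-1 = expR (- (alpha * eta + 1) * L) * expR (alpha * eta * L).
      rewrite -expRD -(lnK (x := n%:R)) ?posrE// -expRN; congr expR.
      by rewrite -/L; ring.
    by rewrite ler_pM// ?expR_ge0 ?powR_ge0.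
  apply: (@le_trans _ _ i.+1%:R^-1).
    by rewrite lef_pV2 ?posrE// ler_nat.
  by rewrite mulrAC -{1}(mul1r i.+1%:R^-1) ler_wpM2r// invr_ge0 ltW.
apply: (@le_trans _ _ (4 * v * (A + (v + 1) * S / ln 2) * (L / i.+1%:R))); last first.
  by rewrite /C [leRHS]mulrDl lerDl mulr_ge0.
rewrite -[leRHS]mulrA ler_wpM2l ?mulr_ge0 ?(ltW v_gt0)//.
rewrite [leRHS]mulrDl -/eps lerD2l.
have -> : (v + 1) * S / ln 2 * (L / i.+1%:R) = (v + 1) * S * (L / i.+1%:R / ln 2).
  by ring.
rewrite -mulrA (mulrA (expR _)) (mulrC _ S) (mulrA (v + 1)).
by rewrite ler_wpM2l// mulr_ge0// addr_ge0// ltW.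
Qed.

Lemma expected_cumulative_gap_rate (alpha : R) : 0 <= alpha ->
  exists2 C : R, 0 <= C & forall n t0, (1 < n)%N ->
    n%:R `^ (- alpha) < prior t0 ->
    (\int[iid_law (pair_law PX (P t0)) n]_s (cumulative_gap prior f s)%:E
      <= (C * ln n%:R ^+ 2)%:E)%E.
Proof.
move=> /expected_gap_rate[C C0 rate]; exists (C * (1 + (ln 2)^-1)) => [|n t0 n1 large].
  by rewrite mulr_ge0// addr_ge0// invr_ge0 ltW.
have L2 := ln2_le n1; have L0 : 0 < ln n%:R :> R by exact: lt_le_trans L2.
have mgap (i : 'I_n) : measurable_fun [set: n.-tuple (X * Y)]
    (fun s => (mix_gap prior f (take i.+1 s))%:E).
  by apply/measurable_EFinP; exact: (measurable_mix_gap_take f_density prior_pmf).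
under eq_integral do rewrite cumulative_gap_tuple -sumEFin.
rewrite ge0_integral_sum//; last first.
  by move=> i s _; rewrite lee_fin mix_gap_ge0.
apply: (@le_trans _ _ (\sum_(i < n) (C * (ln n%:R / i.+1%:R))%:E)%E).
  by apply: lee_sum => i _; exact: rate.
rewrite sumEFin lee_fin -mulr_sumr -mulr_sumr -mulrA ler_wpM2l//.
rewrite expr2 mulrCA ler_wpM2l ?(ltW L0)//.
case: n n1 {large mgap} L2 L0 => // n _ L2 L0; apply: le_trans (harmonic_le_ln R n) _.
rewrite mulrDl mul1r addrC lerD2l mulrC ler_pdivlMr// mul1r//.
Qed.

Lemma measurable_cumulative_gap n :
  measurable_fun [set: n.-tuple (X * Y)] (fun s => cumulative_gap prior f s).
Proof.
rewrite (_ : (fun s : n.-tuple _ => _) =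
    fun s : n.-tuple (X * Y) => \sum_(i < n) mix_gap prior f (take i.+1 s)).
  apply: measurable_sum => i.
  exact: (measurable_mix_gap_take f_density prior_pmf).
by apply/funext => s; exact: cumulative_gap_tuple.
Qed.

(** Markov's inequality applied to the expected cumulative gap. *)
Lemma cumulative_gap_tail (alpha : R) : 0 <= alpha ->
  exists2 C : R, 0 <= C & forall n t0 (c : R), (1 < n)%N -> 0 < c ->
    n%:R `^ (- alpha) < prior t0 ->
    (iid_law (pair_law PX (P t0)) n
       [set s : n.-tuple (X * Y) | (c <= cumulative_gap prior f s)%R]
     <= (C * ln n%:R ^+ 2 / c)%:E)%E.
Proof.
move=> /expected_cumulative_gap_rate[C C0 rate]; exists C => // n t0 c n1 c0 large.
set Q := iid_law _ n.
have gap0 (s : n.-tuple (X * Y)) : 0 <= cumulative_gap prior f s.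
  by rewrite cumulative_gap_tuple sumr_ge0// => i _; exact: mix_gap_ge0.
have mgap : measurable_fun [set: n.-tuple (X * Y)]
    (fun s => (cumulative_gap prior f s)%:E).
  by apply/measurable_EFinP; exact: measurable_cumulative_gap.
have := le_integral_abse Q measurableT mgap c0; rewrite setTI => markov.
rewrite EFinM lee_pdivlMr// muleC.
apply: le_trans (rate n t0 n1 large).
rewrite (_ : [set s | _] = [set s : n.-tuple (X * Y) |
    (c%:E <= `|(cumulative_gap prior f s)%:E|)%E]).
  rewrite (le_trans markov)// le_eqVlt; apply/orP; left; apply/eqP.
  by apply: eq_integral => s _; rewrite gee0_abs// lee_fin.
by apply/seteqP; split => s /=; rewrite ger0_norm// lee_fin.
Qed.

End gap_rates.

(** * The theorem *)

Theorem theorem1 (R : realType) (dX dY : measure_display)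
    (X : measurableType dX) (Y : measurableType dY) (Theta : countType)
    (PX : probability X R)
    (mu : {measure set Y -> \bar R})
    (P : Theta -> R.-pker X ~> Y) (f : Theta -> X -> Y -> R)
    (f_density : forall t, is_cond_density mu (P t) (f t))
    (prior : Theta -> R) (prior_pmf : is_pmf prior)
    (v : R) (v_gt1 : 1 < v)
    (ratio_bounded : forall x y t t', f t x y <= v * f t' x y)
    (eta : R) (eta_gt0 : 0 < eta) (eta_lt1 : eta < 1)
    (prior_eta : (\esum_(t in [set: Theta]) (prior t `^ eta)%:E < +oo)%E) :
  (forall a : R, 0 < a ->
     exists C0 C1 : R,
       forall (dO : measure_display) (Omega : measurableType dO)
         (Pi : probability Omega R) (thetastar : Omega -> Theta)
         (Z : nat -> Omega -> X * Y),
         is_bayes_joint prior PX P Pi thetastar Z ->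
         forall n : nat, (1 <= n)%N ->
           (Pi [set w | (C0 * (ln n%:R / n%:R))%:E <=
                        expected_gap prior f PX P n (thetastar w)]
            <= (C1 * (1 / n%:R `^ a))%:E)%E)
  /\
  (forall a' : R, 0 < a' -> a' <= 1 ->
     exists C2 C3 : R,
       forall (dO : measure_display) (Omega : measurableType dO)
         (Pi : probability Omega R) (thetastar : Omega -> Theta)
         (Z : nat -> Omega -> X * Y),
         is_bayes_joint prior PX P Pi thetastar Z ->
         forall n : nat, (1 <= n)%N ->
           (Pi [set w | (C2 * n%:R `^ a' <=
                         cumulative_gap prior f (sample Z n w))%R]
            <= (C3 * (ln n%:R ^+ 2 / n%:R `^ a'))%:E)%E).
Proof.
have v_gt0 : 0 < v by exact: lt_trans v_gt1.
have [S S0 SE] : exists2 S : R, 0 <= S &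
    (\esum_(t in [set: Theta]) (prior t `^ eta)%:E = S%:E)%E.
  have esum0 : (0 <= \esum_(t in [set: Theta]) (prior t `^ eta)%:E)%E.
    by rewrite esum_ge0// => t _; rewrite lee_fin powR_ge0.
  exists (fine (\esum_(t in [set: Theta]) (prior t `^ eta)%:E)%E).
    exact: fine_ge0.
  by rewrite fineK// ge0_fin_numE.
have eta1 : 0 < 1 - eta by rewrite subr_gt0.
have ln2_gt0 : 0 < ln 2 :> R by rewrite ln_gt0// ltr1n.
have ln2_le n : (1 < n)%N -> ln 2 <= ln n%:R :> R.
  by move=> n1; rewrite ler_ln ?posrE ?ltr0n ?ler_nat//; exact: ltnW.
have powE (n : nat) b : (n%:R `^ (- (b / (1 - eta)))) `^ (1 - eta) = n%:R `^ (- b) :> R.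
  by rewrite -powRrM mulNr divfK// gt_eqF.
have tau0 (n : nat) b : (0 < n)%N -> 0 < n%:R `^ (- (b / (1 - eta))) :> R.
  by move=> n0; rewrite powR_gt0// ltr0n.
split=> [a a0|a' a'0 _].
- have alpha0 : 0 <= a / (1 - eta) by rewrite divr_ge0// ltW.
  have [C C0 rate] := expected_gap_rate PX f_density prior_pmf v_gt1
    ratio_bounded eta_gt0 eta_lt1 SE alpha0.
  exists (C + 1), (S + 1) => dO Omega Pi thetastar Z bayes n n0.
  have mB t : measurable [set s : n.-tuple (X * Y) |
      (((C + 1) * (ln n%:R / n%:R))%:E <= expected_gap prior f PX P n t)%E].
    have [le_t|gt_t] := leP (((C + 1) * (ln n%:R / n%:R))%:E)
      (expected_gap prior f PX P n t).
      by rewrite (_ : mkset _ = setT)//; apply/seteqP; split.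
    by rewrite (_ : mkset _ = set0)//; apply/seteqP; split.
  have [n1|n1] := leqP n 1.
    have nE : n = 1%N by apply/eqP; rewrite eqn_leq n1.
    apply: le_trans (bayes_joint_tail prior_pmf eta_lt1 SE bayes mB
      ltr01 ler01 _) _.
      by move=> t _; exact: probability_le1.
    by rewrite nE !powR1 divr1 !mulr1.
  have L0 : 0 < ln n%:R :> R by exact: lt_le_trans (ln2_le n n1).
  apply: le_trans (bayes_joint_tail prior_pmf eta_lt1 SE bayes mB
    (tau0 n a n0) (lexx 0) _) _.
    move=> t large; rewrite (_ : mkset _ = set0) ?measure0//.
    apply/seteqP; split=> // s /=; apply/negP; rewrite -ltNge.
    have last_lt : (n.-1 < n)%N by rewrite prednK.
    have := rate n (Ordinal last_lt) t n1 large; rewrite /= prednK// => gap_le.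
    rewrite /expected_gap; under eq_integral => w _.
      by rewrite -(take_oversize (n := n) (s := w)) ?size_tuple//; over.
    rewrite (le_lt_trans gap_le)// lte_fin ltr_pM2r ?ltrDl//.
    by rewrite divr_gt0// ltr0n.
  rewrite powE addr0 lee_fin div1r -powRN ler_wpM2r ?powR_ge0//.
  by rewrite lerDl.
- have alpha0 : 0 <= a' / (1 - eta) by rewrite divr_ge0// ltW.
  have [C C0 rate] := cumulative_gap_tail PX f_density prior_pmf v_gt1
    ratio_bounded eta_gt0 eta_lt1 SE alpha0.
  (* C2 exceeds the uniform bound on one gap: at n = 1 the right-hand side
     vanishes, so the event has to be empty. *)
  pose C2 := 4 * v * (v + 1) + 1.
  have C2_gt0 : 0 < C2.
    by rewrite ltr_wpDl// !mulr_ge0 ?addr_ge0// ltW.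
  exists C2, (S / ln 2 ^+ 2 + C / C2) => dO Omega Pi thetastar Z bayes n n0.
  have na0 : 0 < n%:R `^ a' :> R by rewrite powR_gt0// ltr0n.
  have [n1|n1] := leqP n 1.
    have nE : n = 1%N by apply/eqP; rewrite eqn_leq n1.
    rewrite (_ : mkset _ = set0).
      by rewrite measure0 lee_fin nE ln1 expr0n/= mul0r mulr0.
    apply/seteqP; split=> // w /=; apply/negP; rewrite -ltNge.
    rewrite (cumulative_gap_tuple f prior (sample Z n w)).
    apply: (@le_lt_trans _ _ (\sum_(i < n) (4 * v * (v + 1)))).
      apply: ler_sum => i _.
      exact: (mix_gap_le_cst f_density prior_pmf v_gt1 ratio_bounded).
    by rewrite sumr_const card_ord nE powR1 mulr1 mulr1n ltrDl.
  have L2 := ln2_le n n1; have L0 : 0 < ln n%:R :> R by exact: lt_le_trans L2.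
  pose B (t : Theta) := [set s : n.-tuple (X * Y) |
    C2 * n%:R `^ a' <= cumulative_gap prior f s].
  have mB t : measurable (B t).
    rewrite /B -[X in measurable X]setTI.
    apply: measurable_fun_ler => //.
    exact: (measurable_cumulative_gap f_density prior_pmf).
  have c0 : 0 < C2 * n%:R `^ a' by exact: mulr_gt0.
  have q0 : 0 <= C * ln n%:R ^+ 2 / (C2 * n%:R `^ a').
    by rewrite divr_ge0 ?(ltW c0)// mulr_ge0// sqr_ge0.
  apply: le_trans (bayes_joint_tail prior_pmf eta_lt1 SE bayes mB
    (tau0 n a' n0) q0 _) _.
    by move=> t large; exact: rate.
  rewrite powE lee_fin [leRHS]mulrDl lerD//; last first.
    by rewrite invfM [leLHS]mulrACA.
  rewrite powRN [leRHS]mulrA ler_wpM2r ?invr_ge0 ?powR_ge0//.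
  rewrite -mulrA ler_peMr// mulrC ler_pdivlMr ?exprn_gt0// mul1r.
  by rewrite lerXn2r// nnegrE ltW.
Qed.
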